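(* Let $\alpha\in(0,1)$. If $(f_k)_{k\in\mathbb N}\subset BV^\alpha(\mathbb R^n)$ and $f_k\to f$ in $L^1(\mathbb R^n)$ as $k\to+\infty$, then $f\in BV^\alpha(\mathbb R^n)$ with $$|D^\alpha f|(U)\le\liminf_{k\to+\infty}|D^\alpha f_k|(U)$$ for any open set $U\subset\mathbb R^n$.
   Context: For $\alpha\in(0,1)$ let $\mu_{n,\alpha}:=2^\alpha\pi^{-n/2}\,\Gamma\big(\tfrac{n+\alpha+1}{2}\big)/\Gamma\big(\tfrac{1-\alpha}{2}\big)$. For $\varphi\in C^\infty_c(\mathbb R^n;\mathbb R^n)$ the fractional $\alpha$-divergence is $$\mathrm{div}^\alpha\varphi(x):=\mu_{n,\alpha}\int_{\mathbb R^n}\frac{(y-x)\cdot(\varphi(y)-\varphi(x))}{|y-x|^{n+\alpha+1}}\,dy,$$ which is a function in $L^1(\mathbb R^n)\cap L^\infty(\mathbb R^n)$. The space $BV^\alpha(\mathbb R^n)$ consists of all $f\in L^1(\mathbb R^n)$ such that $$\sup\Big\{\int_{\mathbb R^n}f\,\mathrm{div}^\alpha\varphi\,dx:\ \varphi\in C^\infty_c(\mathbb R^n;\mathbb R^n),\ \|\varphi\|_{L^\infty(\mathbb R^n;\mathbb R^n)}\le1\Big\}<+\infty.$$ For $f\in BV^\alpha(\mathbb R^n)$ there is a finite $\mathbb R^n$-valued Radon measure $D^\alpha f$ on $\mathbb R^n$ such that $\int_{\mathbb R^n}f\,\mathrm{div}^\alpha\varphi\,dx=-\int_{\mathbb R^n}\varphi\cdot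 dD^\alpha f$ for all $\varphi\in C^\infty_c(\mathbb R^n;\mathbb R^n)$, and its total variation measure $|D^\alpha f|$ (the fractional variation measure) satisfies, for every open set $U\subset\mathbb R^n$, $$|D^\alpha f|(U)=\sup\Big\{\int_{\mathbb R^n}f\,\mathrm{div}^\alpha\varphi\,dx:\ \varphi\in C^\infty_c(U;\mathbb R^n),\ \|\varphi\|_{L^\infty(U;\mathbb R^n)}\le1\Big\}.$$
   Formalization: The claim f ∈ BV^α is proved under the added (necessary) assumption liminf |D^α f_k|(R^n) < +∞; the inequality is proved for every open U whenever D^α f exists, even if the liminf is infinite. *)

(* Defs.v *)
From HB Require Import structures.
From mathcomp Require Import all_boot all_order all_algebra.
From mathcomp Require Import all_classical all_reals all_analysis.
From mathcomp Require Import measurable_realfun lra.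

Set Implicit Arguments.
Unset Strict Implicit.
Unset Printing Implicit Defensive.
Import Order.TTheory GRing.Theory Num.Theory.
Import numFieldNormedType.Exports.
Local Open Scope classical_set_scope.
Local Open Scope ring_scope.

(* R^n is 'rV[R]_n with its Borel sigma-algebra. *)
HB.instance Definition _ (R : realType) (n : nat) :=
  @isMeasurable.Build (sigma_display (@open 'rV[R]_n)) 'rV[R]_n
    <<s @open 'rV[R]_n >> (@sigma_algebra0 _ setT open)
    (@sigma_algebraC _ open) (@sigma_algebra_bigcup _ setT open).

Lemma sigma_finite_product d1 d2 (T1 : measurableType d1) (T2 : measurableType d2)
    (R : realType) (m1 : {sigma_finite_measure set T1 -> \bar R})
    (m2 : {sigma_finite_measure set T2 -> \bar R}) :
  sigma_finite setT (m1 \x m2)%E.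
Proof.
have /sigma_finiteP[F [TF ndF Foo]] := sigma_finiteT m1.
have /sigma_finiteP[G [TG ndG Goo]] := sigma_finiteT m2.
exists (fun k => F k `*` G k).
  rewrite -setXTT TF TG; apply/seteqP; split => [[x y] [[i _ Fx] [j _ Gy]]|].
    exists (maxn i j) => //=; split.
      by have /subsetPset := ndF _ _ (leq_maxl i j); exact.
    by have /subsetPset := ndG _ _ (leq_maxr i j); exact.
  by move=> [x y] [k _ [Fx Gy]]; split; exists k.
move=> k; have [? ?] := Foo k; have [? ?] := Goo k.
split; first exact: measurableX.
by rewrite product_measure1E// lte_mul_pinfty// ge0_fin_numE.
Qed.

Section lebesgue.
Context {R : realType}.

Lemma open_rV_measurable n (U : set 'rV[R]_n) : open U -> measurable U.
Proof. by move=> oU; exact: sub_sigma_algebra. Qed.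

Lemma open_rV_bigcup n (U : set 'rV[R]_n) : open U ->
  U = \bigcup_(p in [set p : 'rV[rat]_n * rat |
        ball (map_mx ratr p.1 : 'rV[R]_n) (ratr p.2 : R) `<=` U])
      ball (map_mx ratr p.1 : 'rV[R]_n) (ratr p.2 : R).
Proof.
move=> oU; apply/seteqP; split => [x Ux|x [p /= pU]]; last exact: pU.
have /nbhs_ballP[e /= e0 eU] := open_nbhs_nbhs (conj oU Ux).
have [r /itvP re] : exists q : rat, ratr q \in `]0 : R, e / 2[.
  by apply/rat_in_itvoo; rewrite divr_gt0.
have r0 : 0 < ratr r :> R by rewrite re.
have qE i : exists q : rat, ratr q \in `](x ord0 i - ratr r), (x ord0 i + ratr r)[.
  by apply/rat_in_itvoo; rewrite ltrBlDr -addrA ltrDl addr_gt0.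
have [q qx] := choice qE.
exists (\row_i q i, r) => /=.
  move=> y [_ qy]; apply: eU; split => // i j.
  have := qy i j; rewrite !mxE (ord1 i) /ball /= => qyj.
  have := qx j; rewrite in_itv/= => /andP[qx1 qx2].
  have re2 : ratr r < e / 2 by rewrite re.
  rewrite (splitr e) -(subrKA (ratr (q j))) (le_lt_trans (ler_normD _ _))//.
  rewrite ltrD// ?(lt_trans qyj)// (lt_trans _ re2)// ltr_norml.
  by lra.
split => // i j; rewrite !mxE (ord1 i) /ball/=.
have := qx j; rewrite in_itv/= => /andP[qx1 qx2].
by rewrite ltr_norml; lra.
Qed.

Definition rV_cons n (p : measurableTypeR R * 'rV[R]_n) : 'rV[R]_n.+1 := row_mx p.1%:M p.2.

Lemma rV_cons_ball n (q : 'rV[R]_n.+1) (r : R) :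
  @rV_cons n @^-1` ball q r =
  ball (q ord0 ord0) r `*` ball (rsubmx (q : 'rV_(1 + n))) r.
Proof.
have q0 : (q : 'rV_(1 + n)) ord0 (lshift n (ord0 : 'I_1)) = q ord0 ord0.
  by congr (q _ _); exact: val_inj.
apply/seteqP; split => [p [r0 pq]|p [pq0 [r0 pq]]].
  split.
    have := pq ord0 (lshift n (ord0 : 'I_1)).
    by rewrite q0 /rV_cons (@row_mxEl _ 1 1 n) mxE eqxx mulr1n.
  split => // i j; have := pq i (rshift 1 j).
  by rewrite /rV_cons (@row_mxEr _ 1 1 n) !mxE.
split => // i j; rewrite (ord1 i).
have [k ->|k ->] := @split_ordP 1 n j.
  by rewrite (ord1 k) q0 /rV_cons (@row_mxEl _ 1 1 n) mxE eqxx mulr1n.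
by have := pq ord0 k; rewrite /rV_cons (@row_mxEr _ 1 1 n) !mxE.
Qed.

Lemma measurable_rV_cons n : measurable_fun setT (@rV_cons n).
Proof.
apply: (@measurability _ _ _ _ setT (@rV_cons n) (@open 'rV[R]_n.+1)) => //.
move=> _ [U oU <-]; rewrite setTI.
rewrite [X in _ @^-1` X](open_rV_bigcup oU) preimage_bigcup bigcup_mkcond.
apply: countable_bigcupT_measurable => // -[q r]; case: ifPn => // _ /=.
rewrite rV_cons_ball; apply: measurableX.
  by apply: open_measurable; exact: ball_open.
by apply: open_rV_measurable; exact: ball_open.
Qed.

Lemma measurable_rV_head n : measurable_fun setT (fun x : 'rV[R]_n.+1 => x ord0 ord0).
Proof.
apply: (@measurability _ _ _ (measurableTypeR R) setT _ _ (RGenOpens.measurableE R)).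
move=> _ [_ [a [b ->]] <-]; rewrite setTI; apply: open_rV_measurable.
have := @interval_open R (BRight a) (BLeft b) isT isT; set U := [set` _] => oU.
by apply: open_comp => // x _; exact: coord_continuous.
Qed.

Lemma measurable_rV_tail n :
  measurable_fun setT (fun x : 'rV[R]_n.+1 => rsubmx (x : 'rV_(1 + n))).
Proof.
apply: (@measurability _ _ _ _ setT _ (@open 'rV[R]_n)) => //.
move=> _ [U oU <-]; rewrite setTI; apply: open_rV_measurable.
apply: open_comp => // x _ V [P xP PV]; exists (fun i j =>
  if @fintype.split 1 n j is inr k then P i k else setT).
  move=> i j; case: fintype.splitP => [k jk|k jk]; first exact: filterT.
  have -> : j = rshift 1 k by exact: val_inj.
  by have := xP i k; rewrite mxE.
move=> y Py; apply: PV => i j; have := Py i (rshift 1 j).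
rewrite mxE; case: fintype.splitP => [k /= jk|k /= /addnI jk].
  by have := ltn_ord k; rewrite -jk.
by have -> : j = k by exact: val_inj.
Qed.

Lemma rV_cons_sigma_finite n (mu : {sigma_finite_measure set 'rV[R]_n -> \bar R}) :
  sigma_finite setT (pushforward (lebesgue_measure \x mu)%E (@rV_cons n)).
Proof.
have [F UF mF] := sigma_finite_product (@lebesgue_measure R) mu.
pose g (x : 'rV[R]_n.+1) := (x ord0 ord0, rsubmx (x : 'rV_(1 + n))).
have mg : measurable_fun setT g.
  by apply: measurable_fun_pair; [exact: measurable_rV_head|exact: measurable_rV_tail].
have gK p : g (rV_cons p) = p.
  rewrite /g /rV_cons row_mxKr; case: p => x y /=; congr pair.
  have -> : ord0 = lshift n (ord0 : 'I_1) by exact: val_inj.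
  by rewrite (@row_mxEl _ 1 1 n) mxE eqxx.
exists (fun k => g @^-1` F k); first by rewrite -preimage_bigcup -UF.
move=> k; split; first by rewrite -[X in measurable X]setTI; apply: mg => //; have [] := mF k.
rewrite /pushforward -comp_preimage.
by under [X in X @^-1` _]funext do rewrite /= gK; have [] := mF k.
Qed.

Section rV_cons_measure.
Variables (n : nat) (mu : {sigma_finite_measure set 'rV[R]_n -> \bar R}).

Definition rV_cons_measure : set 'rV[R]_n.+1 -> \bar R :=
  pushforward (lebesgue_measure \x mu)%E (@rV_cons n).

Let measurable_preimage (A : set 'rV[R]_n.+1) :
  measurable A -> measurable (@rV_cons n @^-1` A).
Proof. by move=> mA; rewrite -[X in measurable X]setTI; exact: measurable_rV_cons. Qed.

Let rV_cons_measure0 : rV_cons_measure set0 = 0%E.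
Proof. by rewrite /rV_cons_measure /pushforward preimage_set0 measure0. Qed.

Let rV_cons_measure_ge0 A : (0 <= rV_cons_measure A)%E.
Proof. by rewrite /rV_cons_measure /pushforward; exact: measure_ge0. Qed.

Let rV_cons_measure_sigma_additive : semi_sigma_additive rV_cons_measure.
Proof.
move=> F mF tF mUF; rewrite /rV_cons_measure /pushforward preimage_bigcup.
apply: measure_semi_sigma_additive.
- by move=> k; exact: measurable_preimage.
- apply/trivIsetP => i j _ _ ij; rewrite -preimage_setI.
  by move/trivIsetP : tF => /(_ _ _ _ _ ij) ->//; rewrite preimage_set0.
- by rewrite -preimage_bigcup; exact: measurable_preimage.
Qed.

HB.instance Definition _ := isMeasure.Build _ _ _ rV_cons_measure
  rV_cons_measure0 rV_cons_measure_ge0 rV_cons_measure_sigma_additive.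

HB.instance Definition _ := Measure_isSigmaFinite.Build _ _ _ rV_cons_measure
  (rV_cons_sigma_finite mu).

End rV_cons_measure.

(* Lebesgue measure on R^n, as an iterated product of the Lebesgue measure on R;
   lebesgue_rV_box characterizes it. *)
Fixpoint lebesgue_rV n : {sigma_finite_measure set 'rV[R]_n -> \bar R} :=
  if n is m.+1 then rV_cons_measure (lebesgue_rV m) else dirac (0 : 'rV[R]_0).

Lemma lebesgue_rV_box n (a b : 'rV[R]_n) : (forall i, a ord0 i <= b ord0 i) ->
  lebesgue_rV n [set x | forall i, x ord0 i \in `[a ord0 i, b ord0 i]] =
  (\prod_i (b ord0 i - a ord0 i))%:E.
Proof.
elim: n a b => [|n IH] a b ab.
  rewrite big_ord0 /= diracE mem_set//= => i; by case: i.
rewrite big_ord_recl EFinM.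
have head (x : 'rV[R]_n.+1) : (x : 'rV_(1 + n)) ord0 (lshift n (ord0 : 'I_1)) = x ord0 ord0.
  by congr (x _ _); exact: val_inj.
have tail (x : 'rV[R]_n.+1) i : rsubmx (x : 'rV_(1 + n)) ord0 i = x ord0 (lift ord0 i).
  by rewrite mxE; congr (x _ _); exact: val_inj.
pose Q := [set x : 'rV[R]_n | forall i,
  x ord0 i \in `[rsubmx (a : 'rV_(1 + n)) ord0 i, rsubmx (b : 'rV_(1 + n)) ord0 i]].
have -> : lebesgue_rV n.+1 [set x | forall i, x ord0 i \in `[a ord0 i, b ord0 i]] =
    (lebesgue_measure \x lebesgue_rV n)%E (`[a ord0 ord0, b ord0 ord0]%classic `*` Q).
  rewrite /= /rV_cons_measure /pushforward; congr (_ _).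
  have consE0 (p : measurableTypeR R * 'rV[R]_n) : rV_cons p ord0 ord0 = p.1.
    by rewrite -head /rV_cons (@row_mxEl _ 1 1 n) mxE eqxx mulr1n.
  have consES (p : measurableTypeR R * 'rV[R]_n) i : rV_cons p ord0 (lift ord0 i) = p.2 ord0 i.
    by rewrite -tail /rV_cons (@row_mxKr _ 1 1 n).
  apply/seteqP; split => [p pab|p [p0 pQ] i].
    split=> [|i]; first by have := pab ord0; rewrite consE0.
    by have := pab (lift ord0 i); rewrite consES !tail.
  case: (unliftP ord0 i) => [j ->|->]; last by rewrite consE0.
  by have := pQ j; rewrite consES !tail.
have mQ : measurable Q.
  have -> : Q = \bigcap_(i in [set: 'I_n]) ((fun x : 'rV[R]_n => x ord0 i) @^-1`
      `[rsubmx (a : 'rV_(1 + n)) ord0 i, rsubmx (b : 'rV_(1 + n)) ord0 i]%classic).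
    by apply/seteqP; split => [x xQ i _|x xQ i]; [exact: xQ|exact: xQ].
  rewrite -[X in measurable X]setCK; apply: measurableC.
  apply: open_rV_measurable; rewrite openC; apply: closed_bigI => i _.
  by apply: preimage_closed => [x _|]; [exact: coord_continuous|exact: interval_closed].
rewrite product_measure1E//; congr (_ * _)%E.
  rewrite [LHS]lebesgue_measure_itv/= lte_fin; case: ltP => // ba.
  by rewrite (@le_anti _ _ (a ord0 ord0) (b ord0 ord0)) ?subrr// ba ab.
rewrite [LHS]IH; last by move=> i; rewrite !tail; exact: ab.
by congr EFin; apply: eq_bigr => i _; rewrite !tail.
Qed.

End lebesgue.

Section fractional_variation.
Context {R : realType}.

Definition Gamma (s : R) : R :=
  \int[lebesgue_measure]_(t in `]0, +oo[) (t `^ (s - 1) * expR (- t)).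

Section dimension.
Variable n : nat.
Implicit Types (x y : 'rV[R]_n) (f : 'rV[R]_n -> R) (phi : 'rV[R]_n -> 'rV[R]_n).

Definition dotp x y : R := \sum_i x ord0 i * y ord0 i.

(* The library norm `|x| on 'rV[R]_n is the sup norm; it induces the same
   topology but is not the |x| of the fractional divergence. *)
Definition enorm x : R := Num.sqrt (dotp x x).

Fixpoint iter_partial (s : seq 'I_n) phi : 'rV[R]_n -> 'rV[R]_n :=
  if s is i :: s' then fun x => 'D_(delta_mx ord0 i) (iter_partial s' phi) x
  else phi.

(* C^infty: partial derivatives of all orders exist and are continuous. *)
Definition smooth phi : Prop := forall s : seq 'I_n,
  continuous (iter_partial s phi) /\
  forall (i : 'I_n) x, derivable (iter_partial s phi) x (delta_mx ord0 i).

Definition test_field phi : Prop :=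
  smooth phi /\ compact (closure [set x | phi x != 0]).

Definition mu_frac (alpha : R) : R :=
  2 `^ alpha * pi `^ (- (n%:R / 2)) *
  Gamma ((n%:R + alpha + 1) / 2) / Gamma ((1 - alpha) / 2).

(* The integrand is 0 at y = x since 0^-1 = 0. *)
Definition frac_div (alpha : R) phi x : R :=
  mu_frac alpha * \int[lebesgue_rV n]_y
    (dotp (y - x) (phi y - phi x) / enorm (y - x) `^ (n%:R + alpha + 1)).

(* A predicate on representatives, invariant under a.e. equality. *)
Definition BVfrac (alpha : R) f : Prop :=
  (lebesgue_rV n).-integrable setT (EFin \o f) /\
  (ereal_sup [set (\int[lebesgue_rV n]_x (f x * frac_div alpha phi x))%:E |
     phi in [set phi | test_field phi /\
                       'N[lebesgue_rV n]_+oo[EFin \o (enorm \o phi)] <= 1]]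
   < +oo)%E.

(* A charge is finite and countably additive on the Borel sets, and every
   finite Borel measure on R^n is Radon. *)
Definition vector_measure := 'I_n -> {charge set 'rV[R]_n -> \bar R}.

Definition variation_measure (D : vector_measure) (B : set 'rV[R]_n) : \bar R :=
  ereal_sup [set (\sum_(k <oo) (enorm (\row_i fine (D i (A k))))%:E)%E |
    A in [set A : nat -> set 'rV[R]_n |
      [/\ forall k, measurable (A k), trivIset setT A & \bigcup_k A k = B]]].

(* Integral against a signed measure through its Jordan decomposition; the
   value does not depend on the Hahn decomposition that is picked. *)
Definition charge_integral (nu : {charge set 'rV[R]_n -> \bar R}) f : R :=
  let hahn := projT2 (cid (projT2 (cid (Hahn_decomposition nu)))) in
  \int[jordan_pos hahn]_x f x - \int[jordan_neg hahn]_x f x.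

(* D is the measure D^alpha f; by density of the test fields in C_0 there is
   at most one. *)
Definition is_frac_gradient (alpha : R) f (D : vector_measure) : Prop :=
  forall phi, test_field phi ->
    \int[lebesgue_rV n]_x (f x * frac_div alpha phi x) =
    - \sum_i charge_integral (D i) (fun x => phi x ord0 i).

End dimension.
End fractional_variation.

Arguments vector_measure : clear implicits.

(* Main.v *)
Require Import Defs.
From mathcomp Require Import all_boot all_order all_algebra.
From mathcomp Require Import all_classical all_reals all_analysis.
From mathcomp Require Import measurable_realfun lra ring.
Set Implicit Arguments.
Unset Strict Implicit.
Unset Printing Implicit Defensive.
Import Order.TTheory GRing.Theory Num.Theory.
Import numFieldNormedType.Exports.
Local Open Scope classical_set_scope.
Local Open Scope ring_scope.

(* For a test field phi with |phi| <= 1 vanishing off U, the fractional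
   divergence of phi is bounded, hence the integral of f_k div phi tends to that
   of f div phi. Each integral of f_k div phi is - int phi . dD_k and so is at
   most |D_k|(U), since phi is uniformly close to a step function on a finite
   partition of U. Taking the supremum over phi gives the first claim with U = R^n.
   For the second claim the supremum of - int phi . dD over these phi dominates
   |D|(U), because indicators of Borel sets are limits, in L^1 of any finite
   measure, of smooth functions with values in [0, 1]; these Borel sets form a
   sigma-algebra containing the open sets. *)

(** * Smooth functions *)

(** [variation_measure] is a supremum over countable partitions, not over test fields, so each half
    of the duality with test fields has to be proved. The competitors are smooth compactly supported
    fields that vanish off [U]; their support may touch the boundary of [U]. The upper bound
    survives this enlargement because approximation by a step function sees only values on [U], and
    the reverse bound gets easier because no cut-off has to stay away from the boundary.

    For the reverse bound, the natural field takes on each piece of a partition the direction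
    opposite to the vector that [D] assigns to it. Smoothing the indicators must keep the Euclidean
    norm at most 1 at every point and be accurate for all components of [D] at once: hence weights
    of sum at most 1, and L^1 estimates for a finite family of measures.

    For the divergence, the Lipschitz bound on [phi] leaves |y - x|^(1 - n - alpha) near [x], and
    the sup bound leaves |y - x|^(- n - alpha) far away. Summing over dyadic cubes replaces polar
    coordinates. *)

Section flat_exponential.
Context {R : realType}.

(* [p (t^-1) * exp (- t^-1)] for [t > 0] spans a space stable under derivation
   as [p] ranges over polynomials; these are the monomial generators. *)
Definition flat_exp (k : nat) (t : R) : R :=
  if 0 < t then t^-1 ^+ k * expR (- t^-1) else 0.

Lemma flat_exp0_01 t : 0 <= flat_exp 0 t <= 1.
Proof.
rewrite /flat_exp; case: ltP => t0; last by rewrite lexx ler01.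
by rewrite expr0 mul1r expR_ge0 /= expR_le1 oppr_le0 invr_ge0 ltW.
Qed.

Lemma flat_exp0_gt0 t : (0 < flat_exp 0 t) = (0 < t).
Proof.
by rewrite /flat_exp; case: (ltP 0 t) => t0; rewrite ?ltxx ?expr0 ?mul1r ?expR_gt0.
Qed.

(** From 1 + u <= e^u with u = s / k one gets s / k <= e^(s / k); raising to the power [k] gives the
    bound. Dividing by [k] is why [k = 0] is split off. *)
Lemma exprn_expRN_le k (s : R) : 0 <= s -> s ^+ k * expR (- s) <= k%:R ^+ k.
Proof.
case: k => [|k] s0; first by rewrite !expr0 mul1r expR_le1 oppr_le0.
have -> : k.+1%:R ^+ k.+1 = k.+1%:R ^+ k.+1 * expR s * expR (- s) :> R.
  by rewrite -mulrA expRxMexpNx_1 mulr1.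
rewrite ler_wpM2r ?expR_ge0//.
have k0 : 0 < k.+1%:R :> R by rewrite ltr0n.
have -> : expR s = expR (s / k.+1%:R) ^+ k.+1.
  by rewrite -expRM_natl mulrC divfK ?gt_eqF.
rewrite -exprMn lerXn2r ?nnegrE// ?mulr_ge0 ?expR_ge0//.
rewrite mulrC -ler_pdivrMr//; apply: le_trans (expR_ge1Dx _).
by rewrite lerDr.
Qed.

(** Two powers of 1/t are traded for [t ^+ 2]. Quadratic decay is what makes the difference quotient
    at 0 vanish in the limit. *)
Lemma flat_exp_le k t : `|flat_exp k t| <= k.+2%:R ^+ k.+2 * t ^+ 2.
Proof.
rewrite /flat_exp; case: ltP => t0; last by rewrite normr0 mulr_ge0 ?sqr_ge0// exprn_ge0.
rewrite ger0_norm; last by rewrite mulr_ge0 ?expR_ge0// exprn_ge0// invr_ge0 ltW.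
rewrite -ler_pdivrMr ?exprn_gt0//.
have -> : t^-1 ^+ k * expR (- t^-1) / t ^+ 2 = t^-1 ^+ k.+2 * expR (- t^-1).
  by rewrite -[k.+2]addn2 exprD mulrAC -[(_ ^+ 2)^-1]exprVn.
by apply: exprn_expRN_le; rewrite invr_ge0 ltW.
Qed.

(** For t > 0 this is the product rule applied to t^(-k) e^(-1/t), and for t < 0 the function is
    locally 0. At 0 the formula evaluates to 0, and [flat_exp_le] sends the difference quotient
    there. *)
Lemma is_derive_flat_exp k (t : R) :
  is_derive t (1 : R) (flat_exp k) (flat_exp k.+2 t - k%:R * flat_exp k.+1 t).
Proof.
have [t0|t0|->] := ltgtP t 0.
- apply: (@near_eq_is_derive _ _ _ (cst 0)).
    near=> s; rewrite /flat_exp /= ltNge; case: leP => // /negP; case.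
    by apply/negP; rewrite -leNgt ltW//; near: s; exact: lt_nbhsl.
  rewrite /flat_exp ltNge ltW//= mulr0 subrr; exact: is_derive_cst.
- apply: (@near_eq_is_derive R R^o R^o (fun s : R => s^-1 ^+ k * expR (- s^-1))).
    near=> s; rewrite /flat_exp; case: ltP => // /negP; case.
    by apply/negP; rewrite -ltNge; near: s; exact: lt_nbhsr.
  have tn0 : t != 0 by rewrite gt_eqF.
  have dV : is_derive t 1 (fun s : R => s^-1) (- t ^- 2).
    have := @is_deriveV R id t 1 1 tn0 (is_derive_id _ _).
    by rewrite /GRing.scale /= mulr1.
  have dX : is_derive t 1 (fun s : R => s^-1 ^+ k) (k%:R * t^-1 ^+ k.-1 * - t ^- 2).
    have := @is_deriveX R R^o (fun s : R => s^-1) k t 1 _ dV.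
    by congr is_derive; apply/funext => s; rewrite exprfctE.
  have dN : is_derive t 1 (fun s : R => - s^-1) (t ^- 2).
    by have := is_deriveN dV; rewrite opprK.
  have dE : is_derive t 1 (fun s : R => expR (- s^-1)) (expR (- t^-1) * t ^- 2).
    exact: (@is_derive1_comp R expR (fun s : R => - s^-1) t _ _ (is_derive_expR (- t^-1)) dN).
  apply: (is_derive_eq (is_deriveM dX dE)).
  rewrite /GRing.scale /= /flat_exp t0; case: k {dX} => [|k].
    by rewrite !mul0r mulr0 addr0 subr0 expr0 mul1r exprVn mulrC.
  by rewrite /= -!exprVn !exprS; ring.
have -> : flat_exp k.+2 0 - k%:R * flat_exp k.+1 0 = 0.
  by rewrite /flat_exp ltxx mulr0 subrr.
suff h : h^-1 *: ((flat_exp k (h *: 1 + 0) - flat_exp k 0) : R^o) @[h --> 0^'] --> (0 : R).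
  apply: DeriveDef; first by apply/cvg_ex; exists 0.
  exact: cvg_lim h.
apply/cvgrPdist_le => e e0; near=> h.
rewrite sub0r normrN /flat_exp ltxx subr0 addr0 -/(flat_exp k _) /GRing.scale /= mulr1.
have h0 : h != 0 by near: h; exact: nbhs_dnbhs_neq.
rewrite normrM normfV ler_pdivrMl ?normr_gt0//.
apply: le_trans (flat_exp_le _ _) _.
rewrite -normr_id -real_normK ?num_real// normr_id expr2 mulrA mulrC ler_wpM2l//.
rewrite mulrC -ler_pdivlMr ?exprn_gt0 ?ltr0n//.
near: h; apply: dnbhs0_le; rewrite divr_gt0// exprn_gt0// ltr0n.
Unshelve. all: by end_near. Qed.

End flat_exponential.

Section smooth_functions.
Context {R : realType} {n : nat}.
Implicit Types (x : 'rV[R]_n) (psi : 'rV[R]_n -> R).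

(* A class of functions that is visibly stable under partial derivatives, so
   that its members have continuous partial derivatives of all orders. *)
Inductive smooth_alg : ('rV[R]_n -> R) -> Prop :=
| smooth_cst c : smooth_alg (fun=> c)
| smooth_flat k (s a : R) i : smooth_alg (fun x => flat_exp k (s * (x ord0 i - a)))
| smoothD f g : smooth_alg f -> smooth_alg g -> smooth_alg (fun x => f x + g x)
| smoothM f g : smooth_alg f -> smooth_alg g -> smooth_alg (fun x => f x * g x).

Lemma smoothN f : smooth_alg f -> smooth_alg (fun x => - f x).
Proof.
move=> sf; rewrite (_ : (fun x => _) = (fun x => -1 * f x)).
  by apply: smoothM => //; exact: smooth_cst.
by apply/funext => x; rewrite mulN1r.
Qed.

Lemma smoothB f g : smooth_alg f -> smooth_alg g -> smooth_alg (fun x => f x - g x).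
Proof. by move=> sf sg; apply: smoothD => //; exact: smoothN. Qed.

Lemma smoothX f k : smooth_alg f -> smooth_alg (fun x => f x ^+ k).
Proof.
move=> sf; elim: k => [|k IH].
  by under [fun _ => _]funext do rewrite expr0; exact: smooth_cst.
by under [fun _ => _]funext do rewrite exprS; exact: smoothM.
Qed.

Lemma smooth_prod (I : Type) (r : seq I) (F : I -> 'rV[R]_n -> R) :
  (forall i, smooth_alg (F i)) -> smooth_alg (fun x => \prod_(i <- r) F i x).
Proof.
move=> sF; elim: r => [|i r IH].
  by under [fun _ => _]funext do rewrite big_nil; exact: smooth_cst.
by under [fun _ => _]funext do rewrite big_cons; exact: smoothM.
Qed.

Lemma smooth_sum (I : Type) (r : seq I) (F : I -> 'rV[R]_n -> R) :
  (forall i, smooth_alg (F i)) -> smooth_alg (fun x => \sum_(i <- r) F i x).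
Proof.
move=> sF; elim: r => [|i r IH].
  by under [fun _ => _]funext do rewrite big_nil; exact: smooth_cst.
by under [fun _ => _]funext do rewrite big_cons; exact: smoothD.
Qed.

(** Moving along [delta_mx ord0 j] changes coordinate [i] only if [i = j]: the difference quotient
    is then that of [h], and otherwise it is identically 0. *)
Lemma is_derive_coord (h : R -> R) (i j : 'I_n) x (dh : R) :
  is_derive (x ord0 i) 1 h dh ->
  is_derive x (delta_mx ord0 j : 'rV[R]_n) (fun y => h (y ord0 i)) (dh * (i == j)%:R).
Proof.
move=> [dh1 dh2]; have [<-|ij] := eqVneq i j.
  rewrite mulr1.
  have E : (fun h0 : R => h0^-1 *:
        ((h ((h0 *: (delta_mx ord0 i : 'rV[R]_n) + x) ord0 i) - h (x ord0 i)) : R^o)) =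
      (fun h0 : R => h0^-1 *: ((h (h0 *: (1 : R^o) + x ord0 i) - h (x ord0 i)) : R^o)).
    by apply/funext => h0; rewrite !mxE !eqxx mulr1 /GRing.scale /= mulr1.
  by apply: DeriveDef; rewrite /derivable /derive /= E.
rewrite mulr0.
suff E : (fun h0 : R => h0^-1 *:
      ((h ((h0 *: (delta_mx ord0 j : 'rV[R]_n) + x) ord0 i) - h (x ord0 i)) : R^o)) = cst 0.
  apply: DeriveDef; rewrite /derivable /derive /= E; first exact: is_cvg_cst.
  by apply: cvg_lim => //; exact: cvg_cst.
by apply/funext => h0; rewrite !mxE !eqxx (negbTE ij) mulr0 add0r subrr scaler0.
Qed.

Lemma smooth_alg_derive (j : 'I_n) f : smooth_alg f ->
  exists2 df, smooth_alg df & forall x, is_derive x (delta_mx ord0 j : 'rV[R]_n) f (df x).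
Proof.
elim=> [c|k s a i|{}f g _ [df sdf fdf] _ [dg sdg gdg]|{}f g sf [df sdf fdf] sg [dg sdg gdg]].
- by exists (fun=> 0) => [|x]; [exact: smooth_cst|exact: is_derive_cst].
- exists (fun x => (flat_exp k.+2 (s * (x ord0 i - a)) -
      k%:R * flat_exp k.+1 (s * (x ord0 i - a))) * s * (i == j)%:R).
    do ?[apply: smoothM|apply: smoothB|exact: smooth_cst|exact: smooth_flat].
  move=> x; apply: (@is_derive_coord (fun t => flat_exp k (s * (t - a)))).
  apply: (@is_derive1_comp _ (flat_exp k) (fun t => s * (t - a))).
    exact: is_derive_flat_exp.
  have h1 : is_derive (x ord0 i) 1 (fun t : R => t - a) 1.
    by have := @is_deriveB R R^o R^o id (cst a) (x ord0 i) 1 1 0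
      (is_derive_id _ _) (is_derive_cst _ _ _); rewrite subr0.
  by have := @is_deriveZ R R^o R^o _ s (x ord0 i) 1 _ h1; rewrite /GRing.scale /= mulr1.
- by exists (fun x => df x + dg x) => [|x]; [exact: smoothD|exact: is_deriveD].
- exists (fun x => f x * dg x + g x * df x) => [|x].
    by apply: smoothD; exact: smoothM.
  exact: (@is_deriveM R 'rV[R]_n f g).
Qed.

Lemma smooth_alg_continuous f : smooth_alg f -> continuous f.
Proof.
elim=> [c|k s a i|{}f g _ cf _ cg|{}f g _ cf _ cg] x.
- exact: cst_continuous.
- apply: (@continuous_comp _ _ _ (fun x : 'rV[R]_n => x ord0 i)
    (fun t => flat_exp k (s * (t - a)))).
    exact: coord_continuous.
  apply: (@continuous_comp _ _ _ (fun t => s * (t - a)) (flat_exp k)).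
    by apply: cvgM; [exact: cvg_cst|apply: cvgB; [exact: cvg_id|exact: cvg_cst]].
  apply: differentiable_continuous; apply/derivable1_diffP.
  by have [] := is_derive_flat_exp k (s * (x ord0 i - a)).
- by apply: (@continuousD _ _ _ f g x); [exact: cf|exact: cg].
- by apply: (@continuousM _ _ f g x); [exact: cf|exact: cg].
Qed.

Lemma rV_continuous (phi : 'rV[R]_n -> 'rV[R]_n) :
  (forall j, continuous (fun x => phi x ord0 j)) -> continuous phi.
Proof.
move=> cphi x; apply/(@cvgrPdist_le R 'rV[R]_n _ (nbhs x)) => e e0; near=> y.
rewrite [leLHS]/Num.Def.normr/= mx_normrE (bigmax_le _ (ltW e0))//= => -[i j] _.
rewrite !mxE (ord1 i); move: j; near: y; apply: filter_forall => j.
exact: (cvgrPdist_le _ _).1 (cphi j x) e e0.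
Unshelve. all: by end_near. Qed.

Lemma smooth_alg_smooth (phi : 'rV[R]_n -> 'rV[R]_n) :
  (forall j, smooth_alg (fun x => phi x ord0 j)) -> smooth phi.
Proof.
move=> sphi.
pose V (phi : 'rV[R]_n -> 'rV[R]_n) := forall j, smooth_alg (fun x => phi x ord0 j).
have Vd (psi : 'rV[R]_n -> 'rV[R]_n) i x : V psi -> derivable psi x (delta_mx ord0 i).
  move=> Vpsi; apply/derivable_mxP => k j; rewrite (ord1 k).
  by have [df _ /(_ x)[]] := smooth_alg_derive i (Vpsi j).
have VD (psi : 'rV[R]_n -> 'rV[R]_n) i : V psi -> V (fun x => 'D_(delta_mx ord0 i) psi x).
  move=> Vpsi j; have [df sdf psidf] := smooth_alg_derive i (Vpsi j).
  rewrite (_ : (fun x => _) = df)//; apply/funext => x.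
  by rewrite derive_mx ?mxE; [exact: derive_val|exact: Vd].
move=> s; have Vs : V (iter_partial s phi) by elim: s => //= i s IH; exact: VD.
split=> [|i x]; last exact: Vd.
by apply: rV_continuous => j; exact: smooth_alg_continuous.
Qed.

End smooth_functions.

(** * Smooth approximation of Borel sets *)

Section bumps.
Context {R : realType} {n : nat}.
Implicit Types (x q : 'rV[R]_n) (r : R) (U : set 'rV[R]_n).

Lemma continuous_rV_measurable (g : 'rV[R]_n -> R) :
  continuous g -> measurable_fun setT g.
Proof.
move=> cg; apply: (@measurability _ _ _ (measurableTypeR R) setT _ _ (RGenOpens.measurableE R)).
move=> _ [_ [a [b ->]] <-]; rewrite setTI; apply: open_rV_measurable.
have := @interval_open R (BRight a) (BLeft b) isT isT; set U := [set` _] => oU.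
by apply: open_comp => // x _; exact: cg.
Qed.

Lemma smooth_alg_measurable (g : 'rV[R]_n -> R) : smooth_alg g -> measurable_fun setT g.
Proof. by move=> sg; apply: continuous_rV_measurable; exact: smooth_alg_continuous. Qed.

(** The two arguments are the signed distances from [x ord0 i] to the ends of the interval of radius
    [r] about [q ord0 i]. Balls of the library are sup-norm balls, so a product over coordinates is
    positive exactly on the ball. The factors [1] and [-1] match the shape of [smooth_flat]. *)
Definition bump q r x : R := \prod_i
  (flat_exp 0 (1 * (x ord0 i - (q ord0 i - r))) *
   flat_exp 0 (-1 * (x ord0 i - (q ord0 i + r)))).

Lemma smooth_bump q r : smooth_alg (bump q r).
Proof.
by apply: smooth_prod => i; apply: smoothM; exact: smooth_flat.
Qed.

Lemma bump_01 q r x : 0 <= bump q r x <= 1.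
Proof.
have h i : 0 <= flat_exp 0 (1 * (x ord0 i - (q ord0 i - r))) *
   flat_exp 0 (-1 * (x ord0 i - (q ord0 i + r))) <= 1.
  have /andP[a0 a1] := flat_exp0_01 (1 * (x ord0 i - (q ord0 i - r))).
  have /andP[b0 b1] := flat_exp0_01 (-1 * (x ord0 i - (q ord0 i + r))).
  by rewrite mulr_ge0//= mulr_ile1.
rewrite /bump prodr_ge0 ?prodr_ile1//= => i _; first by have /andP[] := h i.
Qed.

Lemma bump_gt0 q r x : (0 < bump q r x) = [forall i, `|q ord0 i - x ord0 i| < r].
Proof.
have h i : (0 < flat_exp 0 (1 * (x ord0 i - (q ord0 i - r))) *
   flat_exp 0 (-1 * (x ord0 i - (q ord0 i + r)))) = (`|q ord0 i - x ord0 i| < r).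
  have /andP[a0 _] := flat_exp0_01 (1 * (x ord0 i - (q ord0 i - r))).
  have /andP[b0 _] := flat_exp0_01 (-1 * (x ord0 i - (q ord0 i + r))).
  apply/idP/idP => [h|].
    have : (0 < flat_exp 0 (1 * (x ord0 i - (q ord0 i - r)))) &&
           (0 < flat_exp 0 (-1 * (x ord0 i - (q ord0 i + r)))).
      rewrite !lt_neqAle a0 b0 !andbT; move: h; rewrite lt_neqAle => /andP[+ _].
      by rewrite eq_sym mulf_eq0 negb_or ![_ == 0]eq_sym.
    by rewrite !flat_exp0_gt0 ltr_norml => /andP[? ?]; lra.
  rewrite ltr_norml => /andP[? ?]; apply: mulr_gt0; rewrite flat_exp0_gt0; lra.
apply/idP/forallP => [b0 i|xr].
  rewrite -h lt_neqAle.
  have /andP[a0 _] := flat_exp0_01 (1 * (x ord0 i - (q ord0 i - r))).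
  have /andP[c0 _] := flat_exp0_01 (-1 * (x ord0 i - (q ord0 i + r))).
  rewrite mulr_ge0// andbT eq_sym.
  move: b0; rewrite lt_neqAle eq_sym => /andP[+ _].
  by apply: contra_neq => e; rewrite /bump (bigD1 i)//= e mul0r.
by apply: prodr_gt0 => i _; rewrite h.
Qed.

(** For [n = 0] the bump is the empty product 1 whatever [r] is, while a ball carries [0 < r] in its
    definition; hence the hypothesis. *)
Lemma bump_neq0_ball q r x : 0 < r -> bump q r x != 0 -> ball q r x.
Proof.
move=> r0 b; have : 0 < bump q r x.
  by rewrite lt_neqAle eq_sym b; have /andP[] := bump_01 q r x.
by rewrite bump_gt0 => /forallP h; split => // i j; rewrite (ord1 i); exact: h.
Qed.

Lemma ball_bump_gt0 q r x : ball q r x -> 0 < bump q r x.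
Proof. by move=> [r0 h]; rewrite bump_gt0; apply/forallP => i; exact: h. Qed.

Definition cube q r : set 'rV[R]_n :=
  [set x | forall i, x ord0 i \in `[q ord0 i - r, q ord0 i + r]].

Lemma cube_compact q r : compact (cube q r).
Proof.
apply: (@rV_compact _ _ (fun i => `[q ord0 i - r, q ord0 i + r]%classic)) => i.
exact: segment_compact.
Qed.

Lemma ball_cube q r : ball q r `<=` cube q r.
Proof.
move=> x [r0 h] i; have := h ord0 i; rewrite /ball /= ltr_norml => /andP[? ?].
by rewrite in_itv /=; apply/andP; split; lra.
Qed.

Lemma open_bumps U : open U -> exists b : nat -> 'rV[R]_n -> R,
  [/\ forall k, smooth_alg (b k), forall k x, 0 <= b k x <= 1,
      forall k x, ~ U x -> b k x = 0,
      forall k, exists2 K : set 'rV[R]_n, compact K & forall x, b k x != 0 -> K x &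
      forall x, U x -> exists k, 0 < b k x].
Proof.
move=> oU.
pose P (p : 'rV[rat]_n * rat) := 0 < (ratr p.2 : R) /\
  ball (map_mx ratr p.1 : 'rV[R]_n) (ratr p.2 : R) `<=` U.
(* Natural numbers code rational balls; a number that codes no ball inside [U] gives the zero
   function, so [b] is a total sequence. *)
pose b k := if (unpickle k : option ('rV[rat]_n * rat)) is Some p then
  if `[< P p >] then bump (map_mx ratr p.1 : 'rV[R]_n) (ratr p.2 : R) else fun=> 0
  else fun=> 0.
have bP (Q : ('rV[R]_n -> R) -> Prop) k : Q (fun=> 0) ->
    (forall p, P p -> Q (bump (map_mx ratr p.1) (ratr p.2))) -> Q (b k).
  rewrite /b; case: unpickle => // p Q0 QP; case: asboolP => // /QP; exact.
exists b; split.
- by move=> k; apply: (bP smooth_alg); [exact: smooth_cst|move=> *; exact: smooth_bump].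
- move=> k x; apply: (bP (fun g => 0 <= g x <= 1)); first by rewrite lexx ler01.
  by move=> *; exact: bump_01.
- move=> k x nUx; apply: (bP (fun g => g x = 0)) => // p [p0 pU].
  apply/eqP/negPn/negP => /(bump_neq0_ball p0) /pU; exact: nUx.
- move=> k.
  apply: (bP (fun g => exists2 K : set 'rV[R]_n, compact K & forall x, g x != 0 -> K x)).
    by exists set0 => [|x]; [exact: compact0|rewrite eqxx].
  move=> p [p0 _]; exists (cube (map_mx ratr p.1) (ratr p.2)); first exact: cube_compact.
  by move=> x /(bump_neq0_ball p0) /ball_cube.
- move=> x; rewrite {1}(open_rV_bigcup oU) => -[p /= pU px].
  exists (pickle p); rewrite /b pickleK; case: asboolP => [_|]; first exact: ball_bump_gt0.
  by case; split => //; case: px.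
Qed.

Lemma prod_onem_01 (I : Type) (s : seq I) (F : I -> R) :
  (forall i, 0 <= F i <= 1) -> 0 <= \prod_(i <- s) (1 - F i) <= 1.
Proof.
move=> F01; have h i : 0 <= 1 - F i <= 1 by have := F01 i; lra.
by rewrite prodr_ge0 ?prodr_ile1//= => i _; have /andP[] := h i.
Qed.

(* [1 - (\prod_(k < m) (1 - b k)) ^ m], for the bumps [b k] of [open_bumps],
   tends to 1 wherever some [b k] is positive and vanishes elsewhere; no compact
   exhaustion of [U] and no cut-off equal to 1 on a compact set is needed. *)
Lemma open_indic_approx U : open U -> exists eta : nat -> 'rV[R]_n -> R,
  [/\ forall m, smooth_alg (eta m), forall m x, 0 <= eta m x <= 1,
      forall m x, ~ U x -> eta m x = 0,
      forall m, exists2 K : set 'rV[R]_n, compact K & forall x, eta m x != 0 -> K x &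
      forall x, eta m x @[m --> \oo] --> (\1_U x : R)].
Proof.
move=> /open_bumps[b [sb b01 bU bK bpos]].
pose p m x := \prod_(k < m) (1 - b k x).
have p01 m x : 0 <= p m x <= 1 by exact: prod_onem_01.
exists (fun m x => 1 - p m x ^+ m); split.
- move=> m; apply: smoothB; first exact: smooth_cst.
  apply: smoothX; apply: smooth_prod => k; apply: smoothB => //; exact: smooth_cst.
- move=> m x; have /andP[p0 p1] := p01 m x.
  by rewrite subr_ge0 exprn_ile1//= lerBlDr lerDl exprn_ge0.
- move=> m x Ux; rewrite /p big1 ?expr1n ?subrr// => k _; by rewrite bU// subr0.
- move=> m; have [K cK bKK] : exists2 K : set 'rV[R]_n, compact K &
      forall x k, (k < m)%N -> b k x != 0 -> K x.
    elim: m => [|m [K cK IH]]; first by exists set0 => //; exact: compact0.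
    have [K' cK' bK'] := bK m; exists (K `|` K'); first exact: compactU.
    move=> x k; rewrite ltnS leq_eqVlt => /predU1P[->|km] bx; first by right; exact: bK'.
    by left; exact: IH km bx.
  exists K => // x; apply: contra_neqP => nKx.
  rewrite /p big1 ?expr1n ?subrr// => k _.
  suff -> : b k x = 0 by rewrite subr0.
  by apply/eqP/negPn/negP => bx; apply: nKx; exact: bKK (ltn_ord k) bx.
- move=> x; rewrite indicE; have [/set_mem Ux|nUx] := boolP (x \in U); last first.
    apply: cvg_near_cst; apply: nearW => m.
    rewrite /p big1 ?expr1n ?subrr// => k _; rewrite bU ?subr0//.
    by move=> Ux; move: nUx; rewrite mem_set.
  have [k bk] := bpos _ Ux.
  rewrite -[X in _ --> X](subr0 1); apply: cvgB; first exact: cvg_cst.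
  have z1 : `|1 - b k x| < 1 by have := b01 k x; rewrite ltr_norml => ?; apply/andP; split; lra.
  (* Once [m > k], the factor [1 - b k x] bounds the whole product, so the [m]-th power lies below a
     geometric sequence of ratio less than 1. *)
  apply: (@squeeze_cvgr _ _ _ _ (fun=> 0) (fun m => (1 - b k x) ^+ m)).
  + near=> m; have /andP[p0 p1] := p01 m x; rewrite exprn_ge0//= lerXn2r ?nnegrE//.
      by have := b01 k x; lra.
    have km : (k < m)%N by near: m; exists k.+1.
    rewrite /p (bigD1 (Ordinal km))//= ler_piMr//; first by have := b01 k x; lra.
    apply: prodr_ile1 => i _; have := b01 i x; lra.
  + exact: cvg_cst.
  + exact: cvg_expr.
Unshelve. all: by end_near. Qed.

End bumps.

(** * Approximation in L^1 of finitely many finite measures at once *)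

Section L1_approximation.
Context {R : realType} {n : nat} {I : finType}.
Variable nu : I -> {finite_measure set 'rV[R]_n -> \bar R}.
Implicit Types (g psi : 'rV[R]_n -> R) (A : set 'rV[R]_n).

Lemma finite_measure_bounded_cvg d (T : measurableType d) (mu : {finite_measure set T -> \bar R})
    (g_ : nat -> T -> R) (g : T -> R) (C : R) :
  (forall m, measurable_fun setT (g_ m)) -> measurable_fun setT g ->
  (forall m x, `|g_ m x| <= C) -> (forall x, g_ m x @[m --> \oo] --> g x) ->
  (\int[mu]_x `|g x - g_ m x|%:E)%E @[m --> \oo] --> 0%E.
Proof.
move=> mg_ mg gC g_g.
have [//|||||_ h _] := @dominated_convergence _ _ _ mu setT measurableT
    (fun m x => (g_ m x)%:E) (fun x => (g x)%:E) (EFin \o cst C).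
- by move=> m; exact/measurable_EFinP.
- exact/measurable_EFinP.
- by apply: aeW => x _; apply/fine_cvgP; split; [exact: nearW|exact: g_g].
- exact: finite_measure_integrable_cst.
- by apply: aeW => x m _ /=; rewrite lee_fin.
- apply: cvg_trans h; apply: near_eq_cvg; apply: nearW => m.
  by apply: eq_integral => x _; rewrite -EFinB /= distrC.
Qed.

Lemma cvge0_near_le (u : nat -> \bar R) (e : R) : 0 < e ->
  u m @[m --> \oo] --> 0%E -> \forall m \near \oo, (u m <= e%:E)%E.
Proof.
move=> e0 u0; have eE : (0%:E < e%:E :> \bar R)%E by rewrite lte_fin.
have : \forall m \near \oo, (u m < e%:E)%E.
  exact: (u0 _ (open_nbhs_nbhs (conj (@open_ereal_lt_ereal _ e%:E) eE))).
by apply: filterS => m /ltW.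
Qed.

(** A single [psi] must serve every [nu i]: the family will consist of the positive and negative
    Jordan parts of all components of a vector measure. *)
Definition smooth_approx g := forall e : R, 0 < e -> exists psi,
  [/\ smooth_alg psi, forall x, 0 <= psi x <= 1 &
      forall i, (\int[nu i]_x `|g x - psi x|%:E <= e%:E)%E].

Lemma smooth_approx_onem g : smooth_approx g -> smooth_approx (fun x => 1 - g x).
Proof.
move=> ag e /ag[psi [spsi psi01 gpsi]]; exists (fun x => 1 - psi x); split.
- by apply: smoothB => //; exact: smooth_cst.
- by move=> x; have := psi01 x; lra.
- move=> i; apply: le_trans (gpsi i); rewrite le_eqVlt; apply/orP; left; apply/eqP.
  apply: eq_integral => x _; congr EFin; rewrite -normrN; congr (`|_|); ring.
Qed.

Lemma ler_distM01 (a b c d : R) : 0 <= a <= 1 -> 0 <= d <= 1 ->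
  `|a * b - c * d| <= `|b - d| + `|a - c|.
Proof.
move=> /andP[a0 a1] /andP[d0 d1].
have -> : a * b - c * d = a * (b - d) + (a - c) * d by ring.
rewrite (le_trans (ler_normD _ _))// !normrM (ger0_norm a0) (ger0_norm d0).
by apply: lerD; [exact: ler_piMl|exact: ler_piMr].
Qed.

Lemma integral_dist_le2 (mu : {measure set 'rV[R]_n -> \bar R}) (f f1 f2 : 'rV[R]_n -> R) :
  measurable_fun setT f -> measurable_fun setT f1 -> measurable_fun setT f2 ->
  (forall x, `|f x| <= `|f1 x| + `|f2 x|) ->
  (\int[mu]_x `|f x|%:E <= \int[mu]_x `|f1 x|%:E + \int[mu]_x `|f2 x|%:E)%E.
Proof.
move=> mf mf1 mf2 h; rewrite -ge0_integralD//; last 2 first.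
- by apply/measurable_EFinP; exact: measurableT_comp.
- by apply/measurable_EFinP; exact: measurableT_comp.
apply: ge0_le_integral => //.
- by apply/measurable_EFinP; exact: measurableT_comp.
- by apply: emeasurable_funD; apply/measurable_EFinP; exact: measurableT_comp.
- by move=> x _; rewrite -EFinD lee_fin.
Qed.

Lemma smooth_approxM g h : measurable_fun setT g -> measurable_fun setT h ->
  (forall x, 0 <= g x <= 1) -> smooth_approx g -> smooth_approx h ->
  smooth_approx (fun x => g x * h x).
Proof.
move=> mg mh g01 ag ah e e0.
have e20 : 0 < e / 2 by rewrite divr_gt0.
have [psi [spsi psi01 gpsi]] := ag _ e20; have [xi [sxi xi01 hxi]] := ah _ e20.
exists (fun x => psi x * xi x); split; first exact: smoothM.
  move=> x; have /andP[a0 a1] := psi01 x; have /andP[b0 b1] := xi01 x.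
  by rewrite mulr_ge0//= mulr_ile1.
have mpsi := smooth_alg_measurable spsi; have mxi := smooth_alg_measurable sxi.
move=> i; apply: (le_trans (@integral_dist_le2 _ _ (fun x => h x - xi x)
  (fun x => g x - psi x) _ _ _ _)).
- by apply: measurable_funB; exact: measurable_funM.
- exact: measurable_funB.
- exact: measurable_funB.
- by move=> x; exact: ler_distM01.
by rewrite (le_trans (leeD (hxi i) (gpsi i)))// -EFinD -splitr.
Qed.

Lemma smooth_approx_lim (g_ : nat -> 'rV[R]_n -> R) g : (forall m, measurable_fun setT (g_ m)) ->
  measurable_fun setT g -> (forall m x, 0 <= g_ m x <= 1) ->
  (forall x, g_ m x @[m --> \oo] --> g x) ->
  (forall m, smooth_approx (g_ m)) -> smooth_approx g.
Proof.
move=> mg_ mg g01 g_g ag e e0.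
have e20 : 0 < e / 2 by rewrite divr_gt0.
have [m gm] : exists m, forall i, (\int[nu i]_x `|g x - g_ m x|%:E <= (e / 2)%:E)%E.
  (* Finiteness of [I] enters here: finitely many eventual conditions hold at a common index. *)
  suff : \forall m \near \oo, forall i, (\int[nu i]_x `|g x - g_ m x|%:E <= (e / 2)%:E)%E.
    by move=> [m _ /(_ m (leqnn m))]; exists m.
  apply: filter_forall => i.
  have h : (\int[nu i]_x `|g x - g_ m x|%:E)%E @[m --> \oo] --> 0%E.
    apply: (@finite_measure_bounded_cvg _ _ _ _ _ 1) => // m x.
    by have /andP[? ?] := g01 m x; rewrite ger0_norm.
  exact: cvge0_near_le h.
have [psi [spsi psi01 gpsi]] := ag m _ e20; exists psi; split => // i.
have mpsi := smooth_alg_measurable spsi.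
apply: (le_trans (@integral_dist_le2 _ _ (fun x => g x - g_ m x)
  (fun x => g_ m x - psi x) _ _ _ _)).
- exact: measurable_funB.
- exact: measurable_funB.
- exact: measurable_funB.
- by move=> x; rewrite -[X in `|X| <= _](subrKA (g_ m x)) ler_normD.
by rewrite (le_trans (leeD (gm i) (gpsi i)))// -EFinD -splitr.
Qed.

Lemma smooth_approx_indic A : measurable A -> smooth_approx \1_A.
Proof.
pose S := [set A | measurable A /\ smooth_approx (\1_A : 'rV[R]_n -> R)].
suff sub : <<s open >> `<=` S by move=> /sub[].
have i01 (B : set 'rV[R]_n) x : 0 <= (\1_B x : R) <= 1.
  by rewrite indicE; case: (x \in B); rewrite ?lexx ler01.
have mi (B : set 'rV[R]_n) : measurable B -> measurable_fun setT (\1_B : _ -> R).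
  by move=> mB; exact: measurable_indic.
apply: smallest_sub; last first.
  move=> U oU; have mU := open_rV_measurable oU; split => //.
  have [eta [seta eta01 _ _ etaU]] := open_indic_approx oU.
  apply: (smooth_approx_lim _ _ eta01 etaU); last 1 first.
  - move=> m e e0; exists (eta m); split => // i.
    rewrite (eq_integral (cst 0%E)) ?integral0 ?lee_fin ?ltW// => x _.
    by rewrite subrr normr0.
  - by move=> m; exact: smooth_alg_measurable.
  - exact: mi.
split.
- split; first exact: measurable0.
  move=> e e0; exists (fun=> 0); split; [exact: smooth_cst|by rewrite lexx ler01|] => i.
  rewrite (eq_integral (cst 0%E)) ?integral0 ?lee_fin ?ltW// => x _.
  by rewrite indic0 subrr normr0.
- move=> B [mB aB]; rewrite setTD; split; first exact: measurableC.
  have -> : \1_(~` B) = (fun x => 1 - \1_B x) :> ('rV[R]_n -> R).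
    apply/funext => x; rewrite !indicE in_setC.
    by case: (x \in B) => /=; rewrite ?subrr ?subr0.
  exact: smooth_approx_onem.
- move=> F SF; have mF k : measurable (F k) by have [] := SF k.
  split; first exact: bigcup_measurable.
  (* [1 - p m] is the indicator of the union of the first [m] sets. Unions thus reduce to
     complements, finite products and a pointwise limit, without making the sets disjoint. *)
  pose p m x : R := \prod_(k < m) (1 - \1_(F k) x).
  have p01 m x : 0 <= p m x <= 1 by exact: prod_onem_01.
  have mp m : measurable_fun setT (p m).
    rewrite /p; elim: m => [|m IH].
      by under [fun _ => _]funext do rewrite big_ord0; exact: measurable_cst.
    under [fun _ => _]funext do rewrite big_ord_recr /=.
    apply: measurable_funM => //; apply: measurable_funB => //; exact: mi.
  apply: (@smooth_approx_lim (fun m x => 1 - p m x)).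
  + by move=> m; apply: measurable_funB.
  + by apply: mi; exact: bigcup_measurable.
  + by move=> m x; have := p01 m x; lra.
  + move=> x; rewrite indicE; have [/set_mem [k _ Fkx]|nFx] := boolP (x \in _).
      apply: cvg_near_cst; near=> m.
      have km : (k < m)%N by near: m; exists k.+1.
      by rewrite /p (bigD1 (Ordinal km))//= indicE mem_set// subrr mul0r subr0.
    apply: cvg_near_cst; apply: nearW => m.
    rewrite /p big1 ?subrr// => k _; rewrite indicE memNset ?subr0// => Fkx.
    by move/negP : nFx; apply; rewrite inE; exists k.
  + move=> m; apply: smooth_approx_onem; rewrite /p; elim: m => [|m IH].
      under [fun _ => _]funext do rewrite big_ord0.
      move=> e e0; exists (fun=> 1); split; [exact: smooth_cst|by rewrite lexx ler01|] => i.
      rewrite (eq_integral (cst 0%E)) ?integral0 ?lee_fin ?ltW// => x _.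
      by rewrite subrr normr0.
    under [fun _ => _]funext do rewrite big_ord_recr /=.
    apply: smooth_approxM => //; first exact: mp.
    * apply: measurable_funB => //; exact: mi.
    * exact: p01.
    * by apply: smooth_approx_onem; have [] := SF m.
Unshelve. all: by end_near. Qed.

(** Each term is the difference of two consecutive products, so the sum telescopes. This identity is
    what bounds the sum of the smooth weights by 1. *)
Lemma sum_prod_onem (N : nat) (a : nat -> R) :
  \sum_(k < N) a k * \prod_(j < k) (1 - a j) = 1 - \prod_(j < N) (1 - a j).
Proof.
elim: N => [|N IH]; first by rewrite !big_ord0 subrr.
by rewrite !big_ord_recr /= IH; ring.
Qed.

Lemma ler_dist_prod (N : nat) (a b : nat -> R) :
  (forall j, 0 <= a j <= 1) -> (forall j, 0 <= b j <= 1) ->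
  `|\prod_(j < N) a j - \prod_(j < N) b j| <= \sum_(j < N) `|a j - b j|.
Proof.
move=> a01 b01; elim: N => [|N IH]; first by rewrite !big_ord0 subrr normr0.
rewrite !big_ord_recr /= (le_trans (ler_distM01 _ _ _ _))//; last by rewrite addrC lerD.
rewrite prodr_ge0 ?prodr_ile1//= => j _; by have /andP[] := a01 j.
Qed.

(* The functions [psi k * \prod_(j < k) (1 - psi j)] sum to at most 1 although
   the [psi k] that approximate the disjoint sets may overlap. *)
Lemma disjoint_smooth_approx (A : nat -> set 'rV[R]_n) (N : nat) (U : set 'rV[R]_n) (e : R) :
  open U -> (forall k, measurable (A k)) -> trivIset setT A -> (forall k, A k `<=` U) ->
  0 < e -> exists chi : nat -> 'rV[R]_n -> R,
  [/\ forall k, smooth_alg (chi k), forall k x, 0 <= chi k x,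
      exists2 K : set 'rV[R]_n, compact K & forall k x, chi k x != 0 -> U x /\ K x,
      forall x, \sum_(k < N) chi k x <= 1 &
      forall i k, (k < N)%N -> (\int[nu i]_x `|\1_(A k) x - chi k x|%:E <= e%:E)%E].
Proof.
move=> oU mA tA AU e0.
have N1 : 0 < N.+1%:R :> R by rewrite ltr0n.
(* The error splits into [N.+1] shares: one for the cut-off [eta] and one for each of the [N]
   sets. *)
have d0 : 0 < e / N.+1%:R by rewrite divr_gt0.
set d := e / N.+1%:R in d0.
have mU := open_rV_measurable oU.
have [psi psiP] := choice (fun k => smooth_approx_indic (mA k) d0).
have [eta [seta eta01 etaU etaK etad]] : exists eta : 'rV[R]_n -> R,
    [/\ smooth_alg eta, forall x, 0 <= eta x <= 1, forall x, ~ U x -> eta x = 0,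
      exists2 K : set 'rV[R]_n, compact K & forall x, eta x != 0 -> K x &
      forall i, (\int[nu i]_x `|\1_U x - eta x|%:E <= d%:E)%E].
  have [eta [seta eta01 etaU etaK cveta]] := open_indic_approx oU.
  suff : \forall m \near \oo, forall i, (\int[nu i]_x `|\1_U x - eta m x|%:E <= d%:E)%E.
    move=> [m _ /(_ m (leqnn m)) /= h].
    by exists (eta m); split; [exact: seta|exact: eta01|exact: etaU|exact: etaK|exact: h].
  apply: filter_forall => i.
  have h : (\int[nu i]_x `|\1_U x - eta m x|%:E)%E @[m --> \oo] --> 0%E.
    apply: (@finite_measure_bounded_cvg _ _ _ _ _ 1) => //.
    - by move=> m; exact: smooth_alg_measurable.
    - move=> m x; by have /andP[? ?] := eta01 m x; rewrite ger0_norm.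
  exact: cvge0_near_le h.
have spsi k : smooth_alg (psi k) by have [] := psiP k.
have psi01 k x : 0 <= psi k x <= 1 by have [_ + _] := psiP k; exact.
have psid k i : (\int[nu i]_x `|\1_(A k) x - psi k x|%:E <= d%:E)%E by have [_ _] := psiP k; exact.
have i01 (B : set 'rV[R]_n) x : 0 <= (\1_B x : R) <= 1.
  by rewrite indicE; case: (x \in B); rewrite ?lexx ler01.
(* [eta] supplies the vanishing off [U] and the compact support, neither of which is known for the
   [psi k]. *)
pose chi k x := eta x * (psi k x * \prod_(j < k) (1 - psi j x)).
have schi k : smooth_alg (chi k).
  apply: smoothM => //; apply: smoothM => //; apply: smooth_prod => j.
  by apply: smoothB => //; exact: smooth_cst.
have p01 k x : 0 <= \prod_(j < k) (1 - psi j x) <= 1 by exact: prod_onem_01.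
exists chi; split => //.
- move=> k x; have /andP[? _] := eta01 x; have /andP[? _] := psi01 k x.
  by have /andP[? _] := p01 k x; rewrite /chi !mulr_ge0.
- have [K cK etaKx] := etaK; exists K => // k x; rewrite /chi mulf_eq0 negb_or => /andP[ex _].
  split; last exact: etaKx.
  by apply: contrapT => /etaU; apply/eqP.
- move=> x; rewrite -mulr_sumr (sum_prod_onem N (fun k => psi k x)).
  have /andP[? ?] := eta01 x; have /andP[? ?] := p01 N x.
  by rewrite mulr_ile1//; lra.
move=> i k kN.
have bnd x : `|\1_(A k) x - chi k x| <= `|\1_U x - eta x| + \sum_(j < N) `|\1_(A j) x - psi j x|.
  (* Since [A k] lies in [U] and is disjoint from the earlier sets, its indicator has the same
     product form as [chi k]; the two can then be compared factor by factor. *)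
  have -> : \1_(A k) x = \1_U x * (\1_(A k) x * \prod_(j < k) (1 - \1_(A j) x)) :> R.
    rewrite !indicE; have [/set_mem Akx|] := boolP (x \in A k); last by rewrite mul0r mulr0.
    rewrite mem_set ?mul1r; last exact: AU Akx.
    rewrite big1 // => j _; rewrite indicE memNset ?subr0// => Ajx.
    have jk : j = k :> nat by apply: (tA j k) => //; exists x.
    by have := ltn_ord j; rewrite jk ltnn.
  rewrite (le_trans (ler_distM01 _ _ _ _))//.
    have /andP[? ?] := psi01 k x; have /andP[? ?] := p01 k x.
    by rewrite mulr_ge0//= mulr_ile1.
  rewrite addrC lerD2l (le_trans (ler_distM01 _ _ _ _))//.
  have h : `|\prod_(j < k) (1 - \1_(A j) x) - \prod_(j < k) (1 - psi j x)| <=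
      \sum_(j < k) `|(1 - \1_(A j) x) - (1 - psi j x)|.
    apply: (@ler_dist_prod k (fun j => 1 - \1_(A j) x) (fun j => 1 - psi j x)) => j.
      by have := i01 (A j) x; lra.
    by have := psi01 j x; lra.
  rewrite (le_trans (lerD h (lexx _)))//.
  rewrite (eq_bigr (fun j : 'I_k => `|\1_(A j) x - psi j x|)); last first.
    by move=> j _; rewrite -normrN; congr (`|_|); ring.
  rewrite -(big_ord_recr k (fun j => `|\1_(A j) x - psi j x|)) /=.
  set F := fun j => `|\1_(A j) x - psi j x|.
  rewrite -(big_mkord xpredT F) -[leRHS](big_mkord xpredT F).
  have F0 j : 0 <= F j by exact: normr_ge0.
  by rewrite [leRHS](@big_cat_nat _ _ _ k.+1 0 N)//= lerDl; apply: sumr_ge0.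
have mdist (B : set 'rV[R]_n) g : measurable B -> smooth_alg g ->
    measurable_fun setT (fun x => (`|\1_B x - g x|)%:E).
  move=> mB sg; apply/measurable_EFinP; apply: measurableT_comp => //.
  by apply: measurable_funB; [exact: measurable_indic|exact: smooth_alg_measurable].
have bndI : (\int[nu i]_x `|\1_(A k) x - chi k x|%:E <=
    \int[nu i]_x (`|\1_U x - eta x|%:E + \sum_(j < N) `|\1_(A j) x - psi j x|%:E))%E.
  apply: ge0_le_integral => //.
  - exact: mdist.
  - apply: emeasurable_funD; first exact: mdist.
    by apply: emeasurable_sum => j; exact: mdist.
  - by move=> x _; rewrite sumEFin -EFinD lee_fin.
apply: (le_trans bndI).
rewrite ge0_integralD//; last 3 first.
- exact: mdist.
- by move=> x _; apply: sume_ge0.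
- by apply: emeasurable_sum => j; exact: mdist.
rewrite ge0_integral_sum//; last by move=> j; exact: mdist.
have -> : e = d + \sum_(j < N) d.
  by rewrite sumr_const card_ord -mulrS -mulr_natr divfK// gt_eqF.
apply: (@le_trans _ _ (d%:E + \sum_(j < N) d%:E)%E); last by rewrite sumEFin -EFinD.
by apply: leeD; [exact: etad|apply: lee_sum => j _; exact: psid].
Qed.

End L1_approximation.

(** * The total variation of a vector measure *)

Section dot_product.
Context {R : realType} {n : nat}.
Implicit Types u v w : 'rV[R]_n.

Lemma dotpp_ge0 u : 0 <= dotp u u.
Proof. by apply: sumr_ge0 => i _; rewrite -expr2 sqr_ge0. Qed.

Lemma enorm_ge0 u : 0 <= enorm u.
Proof. exact: sqrtr_ge0. Qed.

Lemma enorm_sqr u : enorm u ^+ 2 = dotp u u.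
Proof. by rewrite sqr_sqrtr// dotpp_ge0. Qed.

Lemma enorm_le1 u : (enorm u <= 1) = (dotp u u <= 1).
Proof. by rewrite -enorm_sqr -[1 in RHS](expr1n _ 2) ler_sqr ?nnegrE// enorm_ge0. Qed.

Lemma dotpZl a u v : dotp (a *: u) v = a * dotp u v.
Proof. by rewrite /dotp mulr_sumr; apply: eq_bigr => i _; rewrite mxE mulrA. Qed.

Lemma dotpC u v : dotp u v = dotp v u.
Proof. by apply: eq_bigr => i _; rewrite mulrC. Qed.

(** This takes the place of Cauchy-Schwarz: it bounds the product of two vectors of the unit ball by
    1, and normalizing one of them yields [dotp_le_enorm]. *)
Lemma ler_dotp_half u v : dotp u v <= (dotp u u + dotp v v) / 2.
Proof.
rewrite /dotp -big_split /= mulr_suml; apply: ler_sum => i _.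
have := sqr_ge0 (u ord0 i - v ord0 i); rewrite sqrrB !expr2; lra.
Qed.

(** At [u = 0] both sides are 0 because [0^-1 = 0], so a set of measure zero needs no separate
    treatment when directions are chosen. *)
Lemma dotp_normalize u : dotp ((enorm u)^-1 *: u) u = enorm u.
Proof.
rewrite dotpZl -enorm_sqr expr2; have [->|u0] := eqVneq (enorm u) 0; first by rewrite invr0 !mul0r.
by rewrite mulKf.
Qed.

Lemma dotp_normalize_le1 u : dotp ((enorm u)^-1 *: u) ((enorm u)^-1 *: u) <= 1.
Proof.
rewrite dotpZl dotpC dotp_normalize.
have [->|u0] := eqVneq (enorm u) 0; first by rewrite mulr0.
by rewrite mulVf.
Qed.

Lemma dotp_le_enorm w u : dotp w w <= 1 -> dotp w u <= enorm u.
Proof.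
move=> w1; have [u0|u0] := eqVneq (enorm u) 0.
  rewrite u0 /dotp big1// => i _.
  have := enorm_sqr u; rewrite u0 expr0n /= => /esym /eqP.
  rewrite psumr_eq0 => [/allP /(_ i (mem_index_enum _)) /=|j _]; last by rewrite -expr2 sqr_ge0.
  by rewrite mulf_eq0 orbb => /eqP ->; rewrite mulr0.
have u1 : 0 < enorm u by rewrite lt_neqAle eq_sym u0 enorm_ge0.
have -> : u = enorm u *: ((enorm u)^-1 *: u) by rewrite scalerA divff// scale1r.
rewrite dotpC dotpZl scalerA divff// scale1r dotpC ler_piMr ?enorm_ge0//.
have := ler_dotp_half w ((enorm u)^-1 *: u); have := dotp_normalize_le1 u; lra.
Qed.

Lemma coord_le_enorm u i : `|u ord0 i| <= enorm u.
Proof.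
rewrite -[leLHS]sqrtr_sqr ler_sqrt ?dotpp_ge0// /dotp (bigD1 i)//= -expr2 lerDl.
by apply: sumr_ge0 => j _; rewrite -expr2 sqr_ge0.
Qed.

End dot_product.

Section bounded_measurable.
Context {R : realType} d (T : measurableType d).
Implicit Types (g h : T -> R) (mu : {finite_measure set T -> \bar R}).

Definition bounded_measurable g := measurable_fun setT g /\ exists C, forall x, `|g x| <= C.

Lemma bounded_measurable_integrable mu g :
  bounded_measurable g -> mu.-integrable setT (EFin \o g).
Proof.
move=> [mg [C gC]]; apply: measurable_bounded_integrable => //.
  by rewrite -ge0_fin_numE// fin_num_measure.
exists C; split; first exact: num_real.
by move=> M CM x _ /=; rewrite (le_trans (gC x))// ltW.
Qed.

Lemma bounded_measurableZ c g : bounded_measurable g -> bounded_measurable (fun x => c * g x).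
Proof.
move=> [mg [C gC]]; split; first exact: measurable_funM.
by exists (`|c| * C) => x; rewrite normrM ler_wpM2l.
Qed.

Lemma bounded_measurableD g h : bounded_measurable g -> bounded_measurable h ->
  bounded_measurable (fun x => g x + h x).
Proof.
move=> [mg [C gC]] [mh [C' hC]]; split; first exact: measurable_funD.
by exists (C + C') => x; rewrite (le_trans (ler_normD _ _))// lerD.
Qed.

Lemma bounded_measurableB g h : bounded_measurable g -> bounded_measurable h ->
  bounded_measurable (fun x => g x - h x).
Proof.
move=> bg bh; under [fun _ => _]funext do rewrite -mulN1r.
by apply: bounded_measurableD => //; exact: bounded_measurableZ.
Qed.

Lemma bounded_measurable_indic (A : set T) : measurable A -> bounded_measurable (\1_A : T -> R).
Proof.
move=> mA; split; first exact: measurable_indic.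
by exists 1 => x; rewrite indicE; case: (x \in A); rewrite ?normr0 ?normr1.
Qed.

Lemma bounded_measurable_sum (I : Type) (s : seq I) (c : I -> R) (g : I -> T -> R) :
  (forall k, bounded_measurable (g k)) ->
  bounded_measurable (fun x => \sum_(k <- s) c k * g k x).
Proof.
move=> bg; elim: s => [|k s IH].
  under [fun _ => _]funext do rewrite big_nil.
  by split; [exact: measurable_cst|exists 0 => x; rewrite normr0].
under [fun _ => _]funext do rewrite big_cons.
by apply: bounded_measurableD => //; exact: bounded_measurableZ.
Qed.

End bounded_measurable.

(** * Integration against a signed measure *)

Section charge_integral.
Context {R : realType} {n : nat}.
Implicit Types (nu : {charge set 'rV[R]_n -> \bar R}) (g h : 'rV[R]_n -> R).

(** The Hahn sets chosen here are literally those inside [charge_integral], so [charge_integralE]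
    holds by conversion; the type records that the Jordan part is finite. *)
Definition charge_pos nu : {finite_measure set 'rV[R]_n -> \bar R} :=
  jordan_pos (projT2 (cid (projT2 (cid (Hahn_decomposition nu))))).

Definition charge_neg nu : {finite_measure set 'rV[R]_n -> \bar R} :=
  jordan_neg (projT2 (cid (projT2 (cid (Hahn_decomposition nu))))).

Lemma charge_integralE nu g :
  charge_integral nu g = \int[charge_pos nu]_x g x - \int[charge_neg nu]_x g x.
Proof. by []. Qed.

Lemma charge_integral_indic nu (A : set 'rV[R]_n) :
  measurable A -> charge_integral nu \1_A = fine (nu A).
Proof.
move=> mA; rewrite charge_integralE /Rintegral !integral_indic// !setIT.
rewrite (jordan_decomp (projT2 (cid (projT2 (cid (Hahn_decomposition nu))))) mA).
rewrite /cadd /= -/(charge_pos nu) -/(charge_neg nu) cscaleN1.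
by rewrite fineD ?fineN// ?fin_numN; exact: fin_num_measure.
Qed.

Lemma charge_integralZ nu c g : bounded_measurable g ->
  charge_integral nu (fun x => c * g x) = c * charge_integral nu g.
Proof.
move=> bg; rewrite !charge_integralE !RintegralZl ?mulrBr//;
  exact: bounded_measurable_integrable.
Qed.

Lemma charge_integralD nu g h : bounded_measurable g -> bounded_measurable h ->
  charge_integral nu (fun x => g x + h x) = charge_integral nu g + charge_integral nu h.
Proof.
move=> bg bh; rewrite !charge_integralE !RintegralD; first by ring.
all: try exact: measurableT.
all: exact: bounded_measurable_integrable.
Qed.

Lemma charge_integral_sum nu (I : Type) (s : seq I) (c : I -> R) (g : I -> 'rV[R]_n -> R) :
  (forall k, bounded_measurable (g k)) ->
  charge_integral nu (fun x => \sum_(k <- s) c k * g k x) =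
  \sum_(k <- s) c k * charge_integral nu (g k).
Proof.
move=> bg; elim: s => [|k s IH].
  under [fun _ => _]funext do rewrite big_nil.
  by rewrite big_nil charge_integralE !Rintegral_cst// !mul0r subrr.
under [fun _ => _]funext do rewrite big_cons.
rewrite charge_integralD ?charge_integralZ//; last 2 first.
- exact: bounded_measurableZ.
- exact: bounded_measurable_sum.
by rewrite IH big_cons.
Qed.

Lemma charge_integral_dist nu g h : bounded_measurable g -> bounded_measurable h ->
  `|charge_integral nu g - charge_integral nu h| <=
  \int[charge_pos nu]_x `|g x - h x| + \int[charge_neg nu]_x `|g x - h x|.
Proof.
move=> bg bh; rewrite !charge_integralE.
have -> (a b c d : R) : a - b - (c - d) = (a - c) - (b - d) by ring.
rewrite -!RintegralB//; try exact: bounded_measurable_integrable.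
rewrite (le_trans (ler_normB _ _))// lerD// le_normr_Rintegral//.
all: exact/bounded_measurable_integrable/bounded_measurableB.
Qed.

End charge_integral.

Section variation.
Context {R : realType} {n : nat}.
Implicit Types (D : vector_measure R n) (U : set 'rV[R]_n) (phi : 'rV[R]_n -> 'rV[R]_n).

Lemma enorm_le1_coord (u : 'rV[R]_n) i : enorm u <= 1 -> -1 <= u ord0 i <= 1.
Proof. by move=> u1; rewrite -ler_norml (le_trans (coord_le_enorm u i)). Qed.

(** [U] is cut along the preimages under [phi] of a grid of mesh [m.+1%:R^-1]. Taking [w k] to be a
    value of [phi] on the cell, not a grid point, preserves the bound on [enorm]. Empty sets pad the
    finite partition to a sequence, the form that [variation_measure] expects. *)
Lemma mesh_partition U phi (m : nat) : measurable U ->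
  (forall i, measurable_fun setT (fun x => phi x ord0 i)) ->
  (forall x, enorm (phi x) <= 1) ->
  exists (N : nat) (A : nat -> set 'rV[R]_n) (w : nat -> 'rV[R]_n),
  [/\ forall k, measurable (A k), trivIset setT A, \bigcup_k A k = U,
      forall k, (N <= k)%N -> A k = set0 &
      (forall k, enorm (w k) <= 1) /\
      forall k x i, A k x -> `|phi x ord0 i - w k ord0 i| <= m.+1%:R^-1].
Proof.
move=> mU mphi phi1.
pose M := m.+1.
have M0 : 0 < M%:R :> R by rewrite ltr0n.
pose y (i : 'I_n) (x : 'rV[R]_n) := (phi x ord0 i + 1) * M%:R.
have y0 i x : 0 <= y i x.
  by have := enorm_le1_coord i (phi1 x); rewrite /y => ?; rewrite mulr_ge0//; lra.
have y2 i x : y i x < (M * 2).+1%:R.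
  have := enorm_le1_coord i (phi1 x); rewrite /y => h.
  apply: (@le_lt_trans _ _ (M * 2)%:R); last by rewrite ltr_nat.
  by rewrite natrM mulrC ler_pM2l//; lra.
(* A cell is given by the integer parts of the [y i x]. The value [M * 2], reached where a
   coordinate equals 1, needs an index of its own, hence the successor. *)
pose T := {ffun 'I_n -> 'I_(M * 2).+1}.
pose B (t : T) := U `&` \bigcap_(i in [set: 'I_n]) ((y i) @^-1` `[(t i)%:R, (t i).+1%:R[%classic).
have mB t : measurable (B t).
  apply: measurableI => //; apply: fin_bigcap_measurable => // i _.
  rewrite -[X in measurable X]setTI.
  have my : measurable_fun setT (y i).
    apply: measurable_funM => //; exact: measurable_funD.
  exact: my.
pose A k := if (insub k : option 'I_#|T|) is Some j then B (enum_val j) else set0.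
have Bt t t' x : B t x -> B t' x -> t = t'.
  move=> [_ tx] [_ t'x]; apply/ffunP => i; apply/val_inj => /=.
  have := tx i I; have := t'x i I; rewrite /= !in_itv /= => /andP[a1 a2] /andP[b1 b2].
  have := le_lt_trans a1 b2; have := le_lt_trans b1 a2; rewrite !ltr_nat !ltnS => h1 h2.
  by apply/eqP; rewrite eqn_leq h1 h2.
pose w k := if pselect (exists x, A k x) is left h then phi (projT1 (cid h)) else 0.
exists #|T|, A, w; split.
- by move=> k; rewrite /A; case: insub.
- move=> i j _ _ [x []]; rewrite /A.
  case: insubP => // i' _ <- Bi; case: insubP => // j' _ <- Bj.
  by rewrite (enum_val_inj (Bt _ _ _ Bi Bj)).
- apply/seteqP; split => [x [k _]|x Ux].
    by rewrite /A; case: insub => // j [].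
  pose t : T := [ffun i => inord (Num.trunc (y i x))].
  exists (enum_rank t) => //; rewrite /A insubT ?ltn_ord// => h.
  have -> : Sub (enum_rank t : nat) h = enum_rank t by exact: val_inj.
  rewrite enum_rankK; split => // i _ /=; rewrite in_itv /= ffunE inordK ?truncn_itv//.
  rewrite -(ltr_nat R); apply: le_lt_trans (y2 i x).
  by have /andP[] := truncn_itv (y0 i x).
- by move=> k kT; rewrite /A insubF// ltnNge kT.
split=> [k|k x i Akx].
  rewrite /w; case: pselect => // _; rewrite enorm_le1 /dotp big1// => i _.
  by rewrite mxE mul0r.
rewrite /w; case: pselect => [h|[]]; last by exists x.
have := projT2 (cid h); set z := projT1 _ => Akz.
have : `|y i x - y i z| <= 1.
  move: Akx Akz; rewrite /A; case: insub => // j [_ /(_ i I) /=] + [_ /(_ i I) /=].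
  rewrite !in_itv /= -!natr1 => /andP[? ?] /andP[? ?].
  by rewrite ler_norml; apply/andP; split; lra.
rewrite /y -mulrBl -div1r ler_pdivlMr// normrM (ger0_norm (ltW M0)).
by congr (`|_| * _ <= _); ring.
Qed.

Lemma ler_variation_measure D U phi : measurable U ->
  (forall i, measurable_fun setT (fun x => phi x ord0 i)) ->
  (forall x, enorm (phi x) <= 1) -> (forall x, ~ U x -> phi x = 0) ->
  ((- \sum_i charge_integral (D i) (fun x => phi x ord0 i))%:E <= variation_measure D U)%E.
Proof.
move=> mU mphi phi1 phiU; apply/lee_addgt0Pr => e e0.
(* [V] is the total mass of all Jordan parts, so a uniform error [m.+1%:R^-1] in each component
   costs at most [V * m.+1%:R^-1], which the choice of [m] keeps below [e]. *)
pose V := \sum_i (fine (charge_pos (D i) setT) + fine (charge_neg (D i) setT)).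
have V0 : 0 <= V by apply: sumr_ge0 => i _; rewrite addr_ge0// fine_ge0.
pose m := Num.trunc (V / e).
have mV : V * m.+1%:R^-1 <= e.
  rewrite ler_pdivrMr ?ltr0n// mulrC -ler_pdivrMr//.
  by have /andP[_ /ltW] := truncn_itv (divr_ge0 V0 (ltW e0)).
have [N [A [w [mA tA UA AN [w1 wA]]]]] := mesh_partition m mU mphi phi1.
have bphi i : bounded_measurable (fun x => phi x ord0 i).
  split => //; exists 1 => x; by rewrite (le_trans (coord_le_enorm _ _)).
pose s i x := \sum_(k < N) w k ord0 i * \1_(A k) x.
have bA (k : 'I_N) : bounded_measurable (\1_(A k) : _ -> R) by exact: bounded_measurable_indic.
have bs i : bounded_measurable (s i) by exact: bounded_measurable_sum.
have phis i x : `|phi x ord0 i - s i x| <= m.+1%:R^-1.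
  have [Ux|nUx] := pselect (U x); last first.
    rewrite phiU// mxE /s big1 ?subrr ?normr0 ?invr_ge0// => k _.
    by rewrite indicE memNset ?mulr0// => Akx; apply: nUx; rewrite -UA; exists k.
  have [k _ Akx] : (\bigcup_k A k) x by rewrite UA.
  have kN : (k < N)%N by rewrite ltnNge; apply/negP => /AN E; move: Akx; rewrite E.
  rewrite /s (bigD1 (Ordinal kN))//= indicE mem_set// mulr1 big1 ?addr0; first exact: wA.
  move=> j jk; rewrite indicE memNset ?mulr0// => Ajx.
  have E : j = k :> nat by apply: (tA j k) => //; exists x.
  by move/negP : jk; apply; apply/eqP/val_inj.
have dist : `|\sum_i charge_integral (D i) (s i) -
    \sum_i charge_integral (D i) (fun x => phi x ord0 i)| <= e.
  apply: le_trans mV; rewrite -sumrB (le_trans (ler_norm_sum _ _ _))// mulr_suml.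
  apply: ler_sum => i _; rewrite distrC (le_trans (charge_integral_dist _ _ _))//.
  have h (mu : {finite_measure set 'rV[R]_n -> \bar R}) :
      \int[mu]_x `|phi x ord0 i - s i x| <= fine (mu setT) * m.+1%:R^-1.
    rewrite mulrC -Rintegral_cst//; apply: le_Rintegral => //.
    - apply: bounded_measurable_integrable; have [mb _] := bounded_measurableB (bphi i) (bs i).
      split; first exact: measurableT_comp.
      by exists m.+1%:R^-1 => x; rewrite normr_id.
    - exact: finite_measure_integrable_cst.
  by rewrite mulrDl lerD.
(* For the step function the integral is a sum of pairings of [- w k], of length at most 1, with the
   vector that [D] assigns to [A k]; each pairing is at most the length of that vector. *)
have sE : - \sum_i charge_integral (D i) (s i) =
    \sum_(k < N) dotp (- w k) (\row_i fine (D i (A k))).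
  under eq_bigr => i _.
    rewrite charge_integral_sum//; under eq_bigr => k _ do rewrite charge_integral_indic//.
    over.
  rewrite exchange_big /= -sumrN; apply: eq_bigr => k _; rewrite -sumrN.
  by apply: eq_bigr => i _; rewrite !mxE mulNr.
have wU : ((\sum_(k < N) dotp (- w k) (\row_i fine (D i (A k))))%:E <= variation_measure D U)%E.
  apply: (@le_trans _ _ (\sum_(0 <= k < N) (enorm (\row_i fine (D i (A k))))%:E)%E).
    rewrite big_mkord sumEFin lee_fin; apply: ler_sum => k _; apply: dotp_le_enorm.
    have := w1 k; rewrite enorm_le1; apply: le_trans; rewrite le_eqVlt; apply/orP; left.
    by apply/eqP; apply: eq_bigr => i _; rewrite !mxE mulrNN.
  apply: (le_trans (nneseries_lim_ge N _)); first by move=> k _ _; rewrite lee_fin enorm_ge0.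
  by apply: ereal_sup_ubound; exists A.
apply: (@le_trans _ _ ((- \sum_i charge_integral (D i) (s i)) + e)%:E).
  by rewrite lee_fin; move: dist; rewrite ler_norml => /andP[? ?]; lra.
by rewrite EFinD leeD2r// sE.
Qed.

(** It suffices to bound the partial sums of a partition. There the competitor is [- u k] weighted
    by [chi k], where [u k] is the direction of the vector measure of [A k]; the sign cancels the
    minus sign of the integration by parts. *)
Lemma variation_measure_le D U (c : \bar R) : open U ->
  (forall phi, test_field phi -> (forall x, enorm (phi x) <= 1) ->
     (forall x, ~ U x -> phi x = 0) ->
     ((- \sum_i charge_integral (D i) (fun x => phi x ord0 i))%:E <= c)%E) ->
  (variation_measure D U <= c)%E.
Proof.
move=> oU hc; apply: ge_ereal_sup => _ [A [mA tA UA] <-].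
apply: lime_le; first by apply: is_cvg_nneseries => k _ _; rewrite lee_fin enorm_ge0.
apply: nearW => N; rewrite big_mkord sumEFin; apply/lee_addgt0Pr => e e0.
(* There are [N * n] terms, each off by at most [d * 2], one [d] per Jordan part. The successor
   keeps the denominator nonzero when [N] or [n] is 0. *)
have K0 : 0 < (N * n * 2).+1%:R :> R by rewrite ltr0n.
pose d := e / (N * n * 2).+1%:R.
have d0 : 0 < d by rewrite divr_gt0.
pose nu (p : 'I_n * bool) := if p.2 then charge_pos (D p.1) else charge_neg (D p.1).
have AU k : A k `<=` U by rewrite -UA; exact: bigcup_sup.
have [chi [schi chi0 [K cK chiK] chi1 chiA]] := disjoint_smooth_approx nu N oU mA tA AU d0.
pose a k : 'rV[R]_n := \row_i fine (D i (A k)).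
pose u k := (enorm (a k))^-1 *: a k.
pose phi x : 'rV[R]_n := \row_i \sum_(k < N) - u k ord0 i * chi k x.
have u1 k : dotp (u k) (u k) <= 1 by exact: dotp_normalize_le1.
have uc k i : `|u k ord0 i| <= 1 by rewrite (le_trans (coord_le_enorm _ _))// enorm_le1.
have sphi i : smooth_alg (fun x => phi x ord0 i).
  under [fun _ => _]funext do rewrite mxE.
  by apply: smooth_sum => k; apply: smoothM => //; exact: smooth_cst.
have phi0 x : (forall k, chi k x = 0) -> phi x = 0.
  by move=> h; apply/rowP => i; rewrite !mxE big1// => k _; rewrite h mulr0.
have tphi : test_field phi.
  split; first exact: smooth_alg_smooth.
  have clK : closed K by apply: compact_closed => //; exact: norm_hausdorff.
  apply: (@subclosed_compact _ _ K) => //; first exact: closed_closure.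
  rewrite [X in _ `<=` X]((closure_id K).1 clK); apply: closure_subset => x /= phix.
  apply: contrapT => nKx; move/eqP : phix; apply; apply: phi0 => k.
  by apply/eqP/negPn/negP => /chiK[].
have phiU x : ~ U x -> phi x = 0.
  by move=> nUx; apply: phi0 => k; apply/eqP/negPn/negP => /chiK[].
(* Expanding the square gives a double sum weighted by [chi k x * chi l x] of inner products at most
   1, hence at most the square of the sum of the weights. *)
have phi1 x : enorm (phi x) <= 1.
  rewrite enorm_le1.
  have -> : dotp (phi x) (phi x) = \sum_(k < N) \sum_(l < N) chi k x * chi l x * dotp (u k) (u l).
    rewrite /dotp.
    under eq_bigr => i _ do rewrite !mxE mulr_suml.
    under eq_bigr => i _ do under eq_bigr => k _ do rewrite mulr_sumr.
    rewrite exchange_big /=; apply: eq_bigr => k _; rewrite exchange_big /=; apply: eq_bigr => l _.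
    by rewrite mulr_sumr; apply: eq_bigr => i _; ring.
  apply: (@le_trans _ _ ((\sum_(k < N) chi k x) * (\sum_(k < N) chi k x))).
    rewrite mulr_suml; apply: ler_sum => k _; rewrite mulr_sumr; apply: ler_sum => l _.
    rewrite ler_piMr ?mulr_ge0//.
    have := ler_dotp_half (u k) (u l); have := u1 k; have := u1 l; lra.
  by rewrite mulr_ile1 ?sumr_ge0.
have bchi (k : 'I_N) : bounded_measurable (chi k).
  split; first exact: smooth_alg_measurable.
  exists 1 => x; rewrite ger0_norm//; apply: le_trans (chi1 x).
  by rewrite (bigD1 k)//= lerDl sumr_ge0.
have bA (k : 'I_N) : bounded_measurable (\1_(A k) : _ -> R) by exact: bounded_measurable_indic.
have CE : - \sum_i charge_integral (D i) (fun x => phi x ord0 i) =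
    \sum_(k < N) \sum_i u k ord0 i * charge_integral (D i) (chi k).
  rewrite exchange_big /= -sumrN; apply: eq_bigr => i _.
  under [fun x => phi x ord0 i]funext do rewrite mxE.
  by rewrite charge_integral_sum// -sumrN; apply: eq_bigr => k _; rewrite mulNr opprK.
have dI (mu : {finite_measure set 'rV[R]_n -> \bar R}) (k : 'I_N) :
    (\int[mu]_x `|\1_(A k) x - chi k x|%:E <= d%:E)%E ->
    \int[mu]_x `|\1_(A k) x - chi k x| <= d.
  move=> h; rewrite /Rintegral -lee_fin fineK//.
  by rewrite ge0_fin_numE ?(le_lt_trans h) ?ltry// integral_ge0.
have dist (k : 'I_N) i : `|charge_integral (D i) (chi k) - a k ord0 i| <= d * 2.
  rewrite mxE -charge_integral_indic// distrC (le_trans (charge_integral_dist _ _ _))//.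
  have := chiA (i, true) k (ltn_ord k); have := chiA (i, false) k (ltn_ord k).
  by rewrite /nu /= mulr_natr mulr2n => /dI ? /dI ?; exact: lerD.
apply: (@le_trans _ _ ((- \sum_i charge_integral (D i) (fun x => phi x ord0 i)) + e)%:E); last first.
  by rewrite EFinD leeD2r// hc.
rewrite lee_fin CE.
have -> : \sum_(k < N) enorm (a k) = \sum_(k < N) \sum_i u k ord0 i * a k ord0 i.
  by apply: eq_bigr => k _; rewrite -dotp_normalize.
rewrite -lerBlDl -sumrB.
apply: (@le_trans _ _ (\sum_(k < N) \sum_(i < n) d * 2)).
  apply: ler_sum => k _; rewrite -sumrB; apply: ler_sum => i _.
  rewrite -mulrBr (le_trans (ler_norm _))// normrM distrC.
  by rewrite -[leRHS]mul1r ler_pM.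
have -> : \sum_(k < N) \sum_(i < n) d * 2 = d * (N * n * 2)%:R.
  rewrite sumr_const card_ord sumr_const card_ord -(mulr_natr _ N) -(mulr_natr _ n) !natrM.
  by ring.
by rewrite /d mulrAC ler_pdivrMr// ler_pM2l// ler_nat leqnSn.
Qed.

End variation.

(** * Boundedness of the fractional divergence *)

Section test_field_bounds.
Context {R : realType} {n : nat}.
Implicit Types (x y u v : 'rV[R]_n) (phi : 'rV[R]_n -> 'rV[R]_n).

Lemma mx_norm_coord u i : `|u ord0 i| <= `|u|.
Proof.
rewrite [leRHS]/Num.Def.normr/= mx_normrE.
exact: (@le_bigmax _ _ _ 0 (fun ij : 'I_1 * 'I_n => `|u ij.1 ij.2|) (ord0, i)).
Qed.

Lemma mx_norm_le u c : 0 <= c -> (forall i, `|u ord0 i| <= c) -> `|u| <= c.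
Proof.
move=> c0 uc; rewrite [leLHS]/Num.Def.normr/= mx_normrE (bigmax_le _ c0)//= => -[i j] _.
by rewrite (ord1 i).
Qed.

Lemma mx_norm_enorm u : `|u| <= enorm u.
Proof. by apply: mx_norm_le => [|i]; [exact: enorm_ge0|exact: coord_le_enorm]. Qed.

Lemma dotp_mx_norm u v : `|dotp u v| <= n%:R * (`|u| * `|v|).
Proof.
rewrite /dotp (le_trans (ler_norm_sum _ _ _))//.
apply: (@le_trans _ _ (\sum_(i < n) `|u| * `|v|)).
  by apply: ler_sum => i _; rewrite normrM ler_pM// mx_norm_coord.
by rewrite sumr_const card_ord mulr_natl.
Qed.

Lemma compactly_supported_bounded (g : 'rV[R]_n -> 'rV[R]_n) (K : set 'rV[R]_n) :
  continuous g -> compact K -> (forall x, ~ K x -> g x = 0) ->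
  exists2 M, 0 <= M & forall x, `|g x| <= M.
Proof.
move=> cg cK gK.
have /compact_bounded[M [_ MP]] : compact (g @` K).
  by apply: continuous_compact => //; exact: continuous_subspaceT.
exists (`|M| + 1) => [|x]; first by rewrite addr_ge0.
have [Kx|nKx] := pselect (K x); last by rewrite gK// normr0 addr_ge0.
by apply: MP; [rewrite (le_lt_trans (ler_norm _))// ltrDl|exists x].
Qed.

Lemma derive_off_support phi i x : ~ closure [set x | phi x != 0] x ->
  'D_(delta_mx ord0 i) phi x = 0.
Proof.
move=> nx; rewrite (@near_eq_derive _ _ _ _ (cst 0)) ?derive_cst//.
have oC : open (~` closure [set x | phi x != 0]) by apply: closed_openC; exact: closed_closure.
have := open_nbhs_nbhs (conj oC nx); apply: filterS => y ny /=.
by apply/eqP/negPn/negP => phiy; apply: ny; exact: subset_closure.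
Qed.

Lemma lipschitz_coord phi (i j : 'I_n) x (t M : R) :
  (forall y, derivable phi y (delta_mx ord0 i)) ->
  (forall y, `|'D_(delta_mx ord0 i) phi y| <= M) ->
  `|phi (t *: delta_mx ord0 i + x) ord0 j - phi x ord0 j| <= M * `|t|.
Proof.
move=> dphi DM.
pose e : 'rV[R]_n := delta_mx ord0 i.
pose g (s : R) : R := phi (s *: e + x) ord0 j.
have dg (s : R) : is_derive s 1 g ('D_e phi (s *: e + x) ord0 j).
  have dj : is_derive (s *: e + x) e (fun y => phi y ord0 j) ('D_e phi (s *: e + x) ord0 j).
    have d1 := dphi (s *: e + x).
    by rewrite (derive_mx d1) mxE; apply/derivableP; exact: (derivable_mxP _ _ _).1.
  have E : (fun h : R => h^-1 *: ((g (h *: (1 : R^o) + s) - g s) : R^o)) =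
      (fun h : R => h^-1 *: ((phi (h *: e + (s *: e + x)) ord0 j - phi (s *: e + x) ord0 j) : R^o)).
    apply/funext => h; rewrite /g; congr (_ *: (phi _ _ _ - _)).
    by rewrite addrA -scalerDl /GRing.scale /= mulr1.
  case: dj => dj1 dj2; apply: DeriveDef; first by rewrite /derivable E.
  by rewrite /derive E.
have cg : continuous g.
  by move=> s; apply: differentiable_continuous; apply/derivable1_diffP; have [] := dg s.
have g0 : g 0 = phi x ord0 j by rewrite /g scale0r add0r.
have gM (s : R) : `|'D_e phi (s *: e + x) ord0 j| <= M.
  by apply: le_trans (DM (s *: e + x)); exact: mx_norm_coord.
rewrite -g0 -/(g t); have [t0|t0] := leP 0 t.
  have [c _ ->] := @MVT_segment R g _ 0 t t0 (fun s _ => dg s) (continuous_subspaceT cg).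
  by rewrite subr0 normrM ler_wpM2r.
have [c _] := @MVT_segment R g _ t 0 (ltW t0) (fun s _ => dg s) (continuous_subspaceT cg).
by rewrite distrC => ->; rewrite sub0r normrM normrN ler_wpM2r.
Qed.

(** [smooth] speaks of partial derivatives only, so the path from [x] to [y] runs parallel to the
    axes: [z k] has already taken its first [k] coordinates from [y]. The [n] segments account for
    the factor [n%:R]. *)
Lemma coordwise_lipschitz phi (M : R) : 0 <= M ->
  (forall i y, derivable phi y (delta_mx ord0 i)) ->
  (forall i y, `|'D_(delta_mx ord0 i) phi y| <= M) ->
  forall x y, `|phi y - phi x| <= M * n%:R * `|y - x|.
Proof.
move=> M0 dphi DM x y.
pose z (k : nat) : 'rV[R]_n := \row_j (if (j < k)%N then y ord0 j else x ord0 j).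
have zS (k : 'I_n) : z k.+1 = (y ord0 k - x ord0 k) *: delta_mx ord0 k + z k.
  apply/rowP => j; rewrite !mxE eqxx /= ltnS.
  have [->|jk] := eqVneq j k; first by rewrite leqnn ltnn mulr1 subrK.
  by rewrite mulr0 add0r leq_eqVlt -(inj_eq val_inj) in jk *; rewrite (negbTE jk).
have z0 : z 0%N = x by apply/rowP => j; rewrite mxE.
have zn : z n = y by apply/rowP => j; rewrite mxE ltn_ord.
apply: mx_norm_le => [|j]; first by rewrite !mulr_ge0.
have -> : (phi y - phi x) ord0 j = \sum_(k < n) (phi (z k.+1) ord0 j - phi (z k) ord0 j).
  rewrite -(big_mkord xpredT (fun k => phi (z k.+1) ord0 j - phi (z k) ord0 j)).
  by rewrite telescope_sumr// zn z0 !mxE.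
rewrite (le_trans (ler_norm_sum _ _ _))//.
apply: (@le_trans _ _ (\sum_(k < n) M * `|y - x|)).
  apply: ler_sum => k _; rewrite zS (le_trans (lipschitz_coord _ _ _ (dphi k) (DM k)))//.
  rewrite ler_wpM2l//; have := mx_norm_coord (y - x) k; by rewrite !mxE.
by rewrite sumr_const card_ord -[_ *+ n]mulr_natr mulrAC.
Qed.

Lemma test_field_bounded_lipschitz phi : test_field phi ->
  exists C, [/\ 0 <= C, forall x, `|phi x| <= C &
                forall x y, `|phi y - phi x| <= C * `|y - x|].
Proof.
move=> [sphi cK]; set K := closure _ in cK.
have [M M0 phiM] : exists2 M, 0 <= M & forall x, `|phi x| <= M.
  apply: (@compactly_supported_bounded phi K) => //; first exact: (sphi [::]).1.
  by move=> x nKx; apply/eqP/negPn/negP => phix; apply: nKx; exact: subset_closure.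
have DM i : exists M, 0 <= M /\ forall x, `|'D_(delta_mx ord0 i) phi x| <= M.
  have [N N0 DN] : exists2 M, 0 <= M & forall x, `|'D_(delta_mx ord0 i) phi x| <= M.
    apply: (@compactly_supported_bounded _ K) => //; first exact: (sphi [:: i]).1.
    by move=> x; exact: derive_off_support.
  by exists N.
have [N NP] := choice DM.
have N0 i : 0 <= N i by have [] := NP i.
pose S := \sum_i N i; have S0 : 0 <= S by exact: sumr_ge0.
exists (M + S * n%:R); split.
- by rewrite addr_ge0// mulr_ge0.
- by move=> x; rewrite (le_trans (phiM x))// lerDl mulr_ge0.
- move=> x y; apply: (@le_trans _ _ (S * n%:R * `|y - x|)).
    apply: coordwise_lipschitz => // i z; first exact: (sphi [::]).2.
    have [_ /(_ z) Dz] := NP i; apply: (le_trans Dz).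
    by rewrite /S (bigD1 i)//= lerDl sumr_ge0.
  by rewrite ler_wpM2r// lerDr.
Qed.

Lemma lebesgue_cube q (r : R) : 0 <= r -> lebesgue_rV n (cube q r) = ((r *+ 2) ^+ n)%:E.
Proof.
move=> r0; pose a : 'rV[R]_n := \row_i (q ord0 i - r).
pose b : 'rV[R]_n := \row_i (q ord0 i + r).
have ab i : a ord0 i <= b ord0 i by rewrite !mxE; lra.
have -> : cube q r = [set x | forall i, x ord0 i \in `[a ord0 i, b ord0 i]].
  by apply/seteqP; split => x h i; have := h i; rewrite !mxE.
rewrite lebesgue_rV_box//.
congr EFin; rewrite (eq_bigr (fun=> r *+ 2)) ?prodr_const ?card_ord// => i _.
by rewrite !mxE mulr2n; ring.
Qed.

Lemma measurable_cube q (r : R) : measurable (cube q r : set 'rV[R]_n).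
Proof.
have -> : cube q r = ~` (~` cube q r) by rewrite setCK.
apply: measurableC; apply: open_rV_measurable; apply: closed_openC.
by apply: compact_closed; [exact: norm_hausdorff|exact: cube_compact].
Qed.

Lemma mem_cube q (r : R) x : `|x - q| <= r -> cube q r x.
Proof.
move=> xq i; have := le_trans (mx_norm_coord (x - q) i) xq.
by rewrite !mxE ler_norml in_itv /= => /andP[? ?]; apply/andP; split; lra.
Qed.

(** By continuity, a value above 1 at one point would persist on a cube around it, and cubes have
    positive measure. *)
Lemma ess_bounded_enorm phi : (0 < n)%N -> continuous phi ->
  ('N[lebesgue_rV n]_+oo[EFin \o (@enorm R n \o phi)] <= 1)%E -> forall x, enorm (phi x) <= 1.
Proof.
(* The norm of exponent [+oo] is defined by cases on whether the whole space has positive measure; a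
   cube of radius 1 settles that. *)
move=> n0 cphi; rewrite unlock; case: ifPn => [_|]; last first.
  move=> /negP[]; have c := @lebesgue_cube 0 1 ler01.
  apply: (@lt_le_trans _ _ (lebesgue_rV n (cube 0 1))).
    by rewrite c lte_fin exprn_gt0// mulrn_wgt0.
  by apply: le_measure; rewrite ?inE//; exact: measurable_cube.
move=> /ess_sup_inf.ess_supP ae x; rewrite leNgt; apply/negP => phix.
have cd : continuous (fun y => dotp (phi y) (phi y)).
  have ci i : continuous (fun y => phi y ord0 i).
    move=> y; apply: (@continuous_comp _ _ _ phi (fun v : 'rV[R]_n => v ord0 i)); first exact: cphi.
    exact: coord_continuous.
  rewrite /dotp; elim: (index_enum _) => [|i s IH].
    by under [fun _ => _]funext do rewrite big_nil; exact: cst_continuous.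
  under [fun _ => _]funext do rewrite big_cons.
  move=> y; apply: (@continuousD _ _ _ (fun y => phi y ord0 i * phi y ord0 i)); last exact: IH.
  by apply: (@continuousM _ _ (fun y => phi y ord0 i)); exact: ci.
pose O := [set y | 1 < dotp (phi y) (phi y)].
have oO : open O.
  by apply: (@open_comp _ _ (fun y => dotp (phi y) (phi y)) [set t | 1 < t]) => //; exact: open_gt.
have gt1 u : (1 < enorm u) = (1 < dotp u u) by rewrite !ltNge enorm_le1.
have Ox : O x by rewrite /O /= -gt1.
have /nbhs_ballP[r /= r0 rO] := open_nbhs_nbhs (conj oO Ox).
have r20 : 0 < r / 2 by rewrite divr_gt0.
have cO : cube x (r / 2) `<=` O.
  move=> y yx; apply: rO; split => // i j; rewrite (ord1 i) /ball /=.
  by have := yx j; rewrite in_itv /= ltr_norml => /andP[? ?]; apply/andP; split; lra.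
have [N [mN N0 aeN]] := ae.
have : (lebesgue_rV n (cube x (r / 2)) <= lebesgue_rV n N)%E.
  apply: le_measure; rewrite ?inE//; first exact: measurable_cube.
  move=> y /cO Oy; apply: aeN => /=; apply/negP; rewrite -ltNge.
  by rewrite ger0_norm ?enorm_ge0// lte_fin gt1.
rewrite lebesgue_cube; last exact: ltW.
move=> h.
have : ((((r / 2) *+ 2) ^+ n)%:E <= 0%:E :> \bar R)%E by rewrite (le_trans h)// N0.
by rewrite lee_fin leNgt exprn_gt0// mulrn_wgt0.
Qed.

End test_field_bounds.

(** * Dyadic estimate of the singular kernel *)

Section kernel_bound.
Context {R : realType} {n : nat}.
Variables (alpha : R).
Hypotheses (n0 : (0 < n)%N) (alpha01 : 0 < alpha < 1).
Let p : R := n%:R + alpha + 1.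

Lemma dyadic_scale (r : R) : 1 <= r -> exists j, 2 ^+ j <= r < 2 ^+ j.+1.
Proof.
move=> r1.
have ex : exists k, r < 2 ^+ k.
  exists (Num.trunc r).+1; have /andP[_ h] := truncn_itv (le_trans ler01 r1).
  apply: (lt_le_trans h); rewrite -natrX ler_nat ltnW//; exact: ltn_expl.
have := ex_minnP ex; case => -[|j] rj jmin; first by move: rj; rewrite expr0 ltNge r1.
exists j; rewrite rj andbT leNgt; apply/negP => /jmin; by rewrite ltnn.
Qed.

(** With r = |y - x|, inner shells are 2^-(j+1) < r <= 2^-j, where r^(2-p) is at most [near_coef j];
    outer shells are 2^j <= r < 2^(j+1), where r^(1-p) is at most [far_coef j]. Each radius is the
    outer one of its shell, which is enlarged to a full cube. *)
Let near_coef (j : nat) : R := 2 `^ (j.+1%:R * (p - 2)).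
Let near_radius (j : nat) : R := (2 ^+ j)^-1.
Let far_coef (j : nat) : R := 2 `^ (- (j%:R * (p - 1))).
Let far_radius (j : nat) : R := 2 ^+ j.+1.

Let p_gt2 : 2 < p.
Proof.
have : 1 <= n%:R :> R by rewrite ler1n.
by case/andP : alpha01 => ? ? ?; rewrite /p; lra.
Qed.

(** Here [c] stands for the minimum of [r] and 1, which controls |phi y - phi x| up to a constant:
    [c <= r] is used for [r <= 1], and [c <= 1] beyond. *)
Lemma dyadic_kernel_bound (r c : R) : 0 < r -> 0 <= c -> c <= r -> c <= 1 ->
  exists j, (r <= near_radius j /\ r * c / r `^ p <= near_coef j) \/
            (r <= far_radius j /\ r * c / r `^ p <= far_coef j).
Proof.
move=> r0 c0 cr c1.
have r0' := ltW r0.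
have pE (q : R) : r `^ q / r `^ p = (r^-1) `^ (p - q).
  rewrite -powRN -powRD; last by apply/implyP => _; rewrite gt_eqF.
  by rewrite -powR_inv1// -powRrM; congr (_ `^ _); ring.
have [r1|r1] := leP r 1.
  have ir1 : 1 <= r^-1 by rewrite invf_ge1.
  have [j /andP[j1 j2]] := dyadic_scale ir1; exists j; left; split.
    by rewrite /near_radius -[r]invrK lef_pV2 ?posrE ?exprn_gt0// invr_gt0.
  apply: (@le_trans _ _ (r ^+ 2 / r `^ p)).
    by rewrite ler_wpM2r ?invr_ge0 ?powR_ge0// expr2 ler_wpM2l.
  rewrite -(powR_mulrn 2 r0') pE /near_coef powRrM powR_mulrn ?ler0n//.
  apply: ge0_ler_powR; first by rewrite subr_ge0; exact: ltW.
  - by rewrite nnegrE invr_ge0.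
  - by rewrite nnegrE exprn_ge0.
  - exact: ltW.
have [j /andP[j1 j2]] := dyadic_scale (ltW r1); exists j; right; split; first exact: ltW.
apply: (@le_trans _ _ (r / r `^ p)).
  by rewrite ler_wpM2r ?invr_ge0 ?powR_ge0// -[leRHS]mulr1 ler_wpM2l.
have := pE 1; rewrite powRr1// => ->.
have p1 : 0 <= p - 1 by have := p_gt2; lra.
rewrite /far_coef powRN powRrM powR_mulrn ?ler0n//.
have h : (2 ^+ j) `^ (p - 1) <= r `^ (p - 1).
  by apply: ge0_ler_powR; rewrite ?nnegrE ?exprn_ge0.
have -> : r^-1 `^ (p - 1) = (r `^ (p - 1))^-1 by rewrite -powR_inv1// -powRrM mulN1r powRN.
by rewrite lef_pV2 ?posrE ?powR_gt0 ?exprn_gt0.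
Qed.

Lemma geometric_sum_le (q : R) (N : nat) : 0 <= q < 1 -> \sum_(j < N) q ^+ j <= (1 - q)^-1.
Proof.
move=> /andP[q0 q1]; have q1' : 0 < 1 - q by rewrite subr_gt0.
rewrite -div1r ler_pdivlMr// mulrC -[X in X <= _]opprK -mulNr opprB -subrX1 opprB.
by rewrite lerBlDr lerDl exprn_ge0.
Qed.

Let powR2_lt1 (s : R) : s < 0 -> 0 <= (2 : R) `^ s < 1.
Proof.
move=> s0; rewrite powR_ge0 /= /powR gt_eqF// expR_lt1.
by rewrite pmulr_llt0// ln_gt0//; lra.
Qed.

Let powR2D (a b : R) : 2 `^ a * 2 `^ b = 2 `^ (a + b).
Proof. by rewrite powRD//; apply/implyP => _; rewrite gt_eqF. Qed.

Let powR2X (a : R) k : (2 `^ a) ^+ k = 2 `^ (a * k%:R).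
Proof. by rewrite powRrM powR_mulrn// powR_ge0. Qed.

(** Multiplied by the volumes of the cubes, the coefficients become constant multiples of 2^(j
    (alpha - 1)) and 2^(- j alpha): two geometric series of ratio less than 1. *)
Lemma dyadic_majorant_bound : exists S : R, forall N,
  \sum_(j < N) (near_coef j * (near_radius j *+ 2) ^+ n +
                far_coef j * (far_radius j *+ 2) ^+ n) <= S.
Proof.
have /andP[a0 a1] := alpha01.
pose q1 : R := 2 `^ (alpha - 1); pose q2 : R := 2 `^ (- alpha).
have nearE j : near_coef j * (near_radius j *+ 2) ^+ n = 2 `^ (p - 2 + n%:R) * q1 ^+ j.
  have -> : near_radius j *+ 2 = 2 `^ (- j%:R + 1).
    by rewrite -powR2D powRN powR_mulrn ?ler0n// powRr1 ?ler0n// -[LHS]mulr_natr.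
  rewrite /near_coef /q1 !powR2X !powR2D; congr (_ `^ _).
  by rewrite /p -natr1; ring.
have farE j : far_coef j * (far_radius j *+ 2) ^+ n = 2 `^ (n%:R * 2) * q2 ^+ j.
  have -> : far_radius j *+ 2 = 2 `^ (j%:R + 2).
    by rewrite -natrD powR_mulrn ?ler0n// addn2 exprS mulr_natl.
  rewrite /far_coef /q2 !powR2X !powR2D; congr (_ `^ _).
  by rewrite /p; ring.
exists (2 `^ (p - 2 + n%:R) * (1 - q1)^-1 + 2 `^ (n%:R * 2) * (1 - q2)^-1) => N.
under eq_bigr => j _ do rewrite nearE farE.
rewrite big_split /= -!mulr_sumr; apply: lerD; rewrite ler_wpM2l ?powR_ge0// geometric_sum_le//;
  by apply: powR2_lt1; lra.
Qed.

(* The far part is integrable because [alpha > 0], the near part because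
   [alpha < 1]; both bounds are uniform in the centre. *)
Lemma kernel_integral_bound (F : 'rV[R]_n -> 'rV[R]_n -> R) (C : R) : 0 <= C ->
  (forall x y, `|F x y| <= C * (`|y - x| * Num.min `|y - x| 1 / `|y - x| `^ p)) ->
  (forall x, measurable_fun setT (F x)) ->
  exists S : R, forall x, (\int[lebesgue_rV n]_y `|F x y|%:E <= S%:E)%E.
Proof.
move=> C0 FC mF; have [S SP] := dyadic_majorant_bound; exists (C * S) => x.
have mc r : measurable_fun setT (\1_(cube x r) : 'rV[R]_n -> R).
  by apply: measurable_indic; exact: measurable_cube.
have nc0 j : 0 <= near_coef j by exact: powR_ge0.
have fc0 j : 0 <= far_coef j by exact: powR_ge0.
pose G j (y : 'rV[R]_n) : \bar R := (near_coef j * \1_(cube x (near_radius j)) y)%:E +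
  (far_coef j * \1_(cube x (far_radius j)) y)%:E.
have i0 r (y : 'rV[R]_n) : 0 <= \1_(cube x r) y :> R by rewrite indicE.
have G0 j y : (0 <= G j y)%E by rewrite /G -EFinD lee_fin addr_ge0// mulr_ge0.
have mG j : measurable_fun setT (G j).
  by apply: emeasurable_funD; apply/measurable_EFinP; exact: measurable_funM.
(* The term of the one shell containing [y] already suffices, the others being nonnegative; at
   [y = x] the assumed bound on [F] is 0. *)
have FG y : (`|F x y|%:E <= C%:E * \sum_(j <oo) G j y)%E.
  have Gj j : (G j y <= \sum_(j <oo) G j y)%E.
    apply: le_trans (nneseries_lim_ge j.+1 _) => //.
    by rewrite big_nat_recr//= leeDr// sume_ge0.
  have [r0|r0] := eqVneq `|y - x| 0.
    rewrite (@le_trans _ _ 0%E)//; last by rewrite mule_ge0// nneseries_ge0.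
    by rewrite lee_fin (le_trans (FC x y))// r0 !mul0r mulr0.
  have rp : 0 < `|y - x| by rewrite normr_gt0 -normr_eq0.
  have [//|||j [[rj hj]|[rj hj]]] := @dyadic_kernel_bound `|y - x| (Num.min `|y - x| 1) rp.
  - by rewrite ge_min lexx.
  - by rewrite ge_min lexx orbT.
  - apply: (@le_trans _ _ (C%:E * G j y)%E); last exact: lee_wpmul2l.
    rewrite /G -EFinD -EFinM lee_fin (le_trans (FC x y))// ler_wpM2l//.
    rewrite [\1_(cube x (near_radius j)) y]indicE mem_set ?mulr1; last exact: mem_cube.
    by rewrite (le_trans hj)// lerDl mulr_ge0.
  - apply: (@le_trans _ _ (C%:E * G j y)%E); last exact: lee_wpmul2l.
    rewrite /G -EFinD -EFinM lee_fin (le_trans (FC x y))// ler_wpM2l//.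
    rewrite [\1_(cube x (far_radius j)) y]indicE mem_set ?mulr1; last exact: mem_cube.
    by rewrite (le_trans hj)// lerDr mulr_ge0.
apply: (@le_trans _ _ (\int[lebesgue_rV n]_y (C%:E * \sum_(j <oo) G j y))%E).
  apply: ge0_le_integral => //.
  - by apply/measurable_EFinP; apply: measurableT_comp => //; exact: mF.
  - by apply: measurable_funeM; exact: ge0_emeasurable_sum.
rewrite ge0_integralZl//; last 2 first.
- exact: ge0_emeasurable_sum.
- by move=> y _; exact: nneseries_ge0.
rewrite integral_nneseries// EFinM lee_wpmul2l//.
apply: lime_le; first by apply: is_cvg_nneseries => j _ _; exact: integral_ge0.
apply: nearW => N; move: (SP N); rewrite -lee_fin; apply: le_trans.
rewrite big_mkord -sumEFin; apply: lee_sum => j _.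
have iE c r : 0 <= c -> 0 <= r ->
    (\int[lebesgue_rV n]_y (c * \1_(cube x r) y)%:E = (c * (r *+ 2) ^+ n)%:E)%E.
  move=> c0 r0; under eq_integral do rewrite EFinM.
  rewrite ge0_integralZl//; last exact/measurable_EFinP.
  rewrite integral_indic//; last exact: measurable_cube.
  by rewrite setIT EFinM; congr (_ * _)%E; exact: lebesgue_cube.
rewrite ge0_integralD//; last 4 first.
- by move=> y _; rewrite lee_fin mulr_ge0.
- by apply/measurable_EFinP; exact: measurable_funM.
- by move=> y _; rewrite lee_fin mulr_ge0.
- by apply/measurable_EFinP; exact: measurable_funM.
by rewrite !iE// ?invr_ge0 ?exprn_ge0.
Qed.

End kernel_bound.

(** * The fractional divergence of a test field is bounded and measurable *)

Section frac_div_bounded.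
Context {R : realType} {n : nat}.
Variable alpha : R.
Hypotheses (n0 : (0 < n)%N) (alpha01 : 0 < alpha < 1).
Implicit Types (phi : 'rV[R]_n -> 'rV[R]_n).

Definition frac_kernel phi (x y : 'rV[R]_n) : R :=
  dotp (y - x) (phi y - phi x) / enorm (y - x) `^ (n%:R + alpha + 1).

(** Joint measurability makes the integral in [y] measurable in [x]. It is checked by coordinates
    because the domain carries the product sigma-algebra. *)
Lemma measurable_frac_kernel phi : continuous phi ->
  measurable_fun [set: 'rV[R]_n * 'rV[R]_n] (fun z => frac_kernel phi z.1 z.2).
Proof.
move=> cphi.
have mphi i : measurable_fun setT (fun x => phi x ord0 i).
  apply: continuous_rV_measurable => y.
  apply: (@continuous_comp _ _ _ phi (fun v : 'rV[R]_n => v ord0 i)); first exact: cphi.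
  exact: coord_continuous.
have mcoord i : measurable_fun setT (fun x : 'rV[R]_n => x ord0 i).
  by apply: continuous_rV_measurable; exact: coord_continuous.
have mdot (g h : 'rV[R]_n * 'rV[R]_n -> 'rV[R]_n) :
    (forall i, measurable_fun setT (fun z => g z ord0 i)) ->
    (forall i, measurable_fun setT (fun z => h z ord0 i)) ->
    measurable_fun setT (fun z => dotp (g z) (h z)).
  by move=> mg mh; apply: measurable_sum => i; exact: measurable_funM.
have md i : measurable_fun [set: 'rV[R]_n * 'rV[R]_n] (fun z => (z.2 - z.1) ord0 i).
  under [fun _ => _]funext do rewrite !mxE.
  apply: measurable_funB.
    exact: (measurableT_comp (mcoord i) measurable_snd).
  exact: (measurableT_comp (mcoord i) measurable_fst).
apply: measurable_funM.
  apply: mdot => // i; under [fun _ => _]funext do rewrite !mxE.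
  apply: measurable_funB.
    exact: (measurableT_comp (mphi i) measurable_snd).
  exact: (measurableT_comp (mphi i) measurable_fst).
under [fun _ => _]funext do rewrite -powRN.
apply: (measurableT_comp (measurable_powR _)).
apply: (measurableT_comp (continuous_measurable_fun (@sqrt_continuous R))).
exact: mdot.
Qed.

Lemma frac_kernel_bound phi : test_field phi -> exists2 C, 0 <= C &
  forall x y, `|frac_kernel phi x y| <=
    C * (`|y - x| * Num.min `|y - x| 1 / `|y - x| `^ (n%:R + alpha + 1)).
Proof.
move=> /test_field_bounded_lipschitz[C [C0 phiC phiL]].
have /andP[a0 _] := alpha01.
(* The factor [n%:R] comes from bounding [dotp] by sup norms, and the 2 from |phi y - phi x| <= 2 C.
   The denominator costs nothing, as the sup norm is at most [enorm]. *)
exists (n%:R * (C * 2)); first by rewrite !mulr_ge0.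
move=> x y; set p := n%:R + alpha + 1.
have p0 : 0 <= p by rewrite !addr_ge0// ltW.
have [r0|r0] := eqVneq `|y - x| 0.
  move/eqP : (r0); rewrite normr_eq0 => /eqP yx0.
  rewrite /frac_kernel yx0 /dotp big1 ?mul0r ?normr0// => [|i _]; last by rewrite mxE mul0r.
  by rewrite !mul0r mulr0.
have rp : 0 < `|y - x| by rewrite lt_neqAle eq_sym r0 normr_ge0.
rewrite /frac_kernel normrM normfV (ger0_norm (powR_ge0 _ _)) [leRHS]mulrA.
apply: ler_pM => //; first by rewrite invr_ge0 powR_ge0.
  apply: (le_trans (dotp_mx_norm _ _)).
  apply: (@le_trans _ _ (n%:R * (`|y - x| * (C * 2 * Num.min `|y - x| 1)))).
    rewrite !ler_wpM2l//; rewrite /Num.min; case: ifP => _.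
      by rewrite (le_trans (phiL x y))// ler_wpM2r// ler_peMr// ler1n.
    by rewrite mulr1 mulr_natr mulr2n (le_trans (ler_normB _ _))// lerD.
  by rewrite le_eqVlt; apply/orP; left; apply/eqP; ring.
rewrite lef_pV2 ?posrE ?powR_gt0//; last exact: lt_le_trans (mx_norm_enorm _).
by apply: ge0_ler_powR; rewrite ?nnegrE ?enorm_ge0// mx_norm_enorm.
Qed.

Lemma frac_div_bounded_measurable phi : test_field phi -> bounded_measurable (frac_div alpha phi).
Proof.
move=> tphi; have cphi : continuous phi by have [+ _] := tphi => /(_ [::])[].
have mF := measurable_frac_kernel cphi.
have mFx x : measurable_fun setT (frac_kernel phi x).
  exact: (measurableT_comp mF (measurable_pair1 x)).
have [C C0 FC] := frac_kernel_bound tphi.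
have [S SP] := kernel_integral_bound n0 alpha01 C0 FC mFx.
have S0 : 0 <= S.
  by rewrite -lee_fin (le_trans _ (SP 0))// integral_ge0.
have -> : frac_div alpha phi =
  fun x => mu_frac n alpha * \int[lebesgue_rV n]_y frac_kernel phi x y by [].
apply: bounded_measurableZ; split.
  (* The Tonelli measurability statement concerns nonnegative integrands, so the positive and
     negative parts are treated apart and subtracted. *)
  have mE : measurable_fun [set: 'rV[R]_n * 'rV[R]_n] (fun z => (frac_kernel phi z.1 z.2)%:E).
    exact/measurable_EFinP.
  have mp := measurable_fun_fubini_tonelli_F (m2 := lebesgue_rV n) _ (measurable_funepos mE)
    (fun z => funepos_ge0 _ z).
  have mn := measurable_fun_fubini_tonelli_F (m2 := lebesgue_rV n) _ (measurable_funeneg mE)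
    (fun z => funeneg_ge0 _ z).
  have := measurableT_comp (@fine_measurable R setT measurableT) (emeasurable_funB mp mn).
  congr measurable_fun; apply/funext => x; rewrite /= /Rintegral integralE /fubini_F.
  by congr (fine (_ - _)%E); apply: eq_integral => y _; rewrite ?funeposE ?funenegE.
exists S => x.
have intF : (lebesgue_rV n).-integrable setT (EFin \o frac_kernel phi x).
  apply/integrableP; split; first by apply/measurable_EFinP; exact: mFx.
  by rewrite (le_lt_trans (SP x))// ltry.
rewrite (le_trans (le_normr_Rintegral _ intF))// -lee_fin fineK ?SP//.
by rewrite ge0_fin_numE ?integral_ge0// (le_lt_trans (SP x))// ltry.
Qed.

End frac_div_bounded.

(** * Passage to the limit and lower semicontinuity *)

Section lower_semicontinuity.
Context {R : realType}.

Lemma le_limn_einf (u v : nat -> \bar R) : (forall k, u k <= v k)%E ->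
  (limn_einf u <= limn_einf v)%E.
Proof.
move=> uv; rewrite !limn_einf_lim; apply: lee_lim; [exact: is_cvg_einfs..|].
apply: nearW => m; apply: le_ereal_inf_tmp => _ [k mk <-].
by apply: le_trans (uv k); apply: ereal_inf_lbound; exists k.
Qed.

Lemma integrable_bounded_mul d (T : measurableType d)
    (mu : {measure set T -> \bar R}) (f g : T -> R) :
  mu.-integrable setT (EFin \o f) -> bounded_measurable g ->
  mu.-integrable setT (EFin \o (fun x => f x * g x)).
Proof.
move=> intf [mg [C gC]]; have mf : measurable_fun setT f.
  exact/measurable_EFinP/(measurable_int mu).
apply: (@le_integrable _ _ _ mu _ measurableT _ (EFin \o (fun x => C * f x))).
- by apply/measurable_EFinP; exact: measurable_funM.
- move=> x _ /=; rewrite lee_fin !normrM mulrC ler_wpM2r//.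
  by rewrite (le_trans (gC x))// ler_norm.
- have := @integrableZl _ _ _ mu setT measurableT C _ intf.
  by apply: eq_integrable => // x _ /=; rewrite EFinM.
Qed.

Lemma cvg_integral_mul d (T : measurableType d) (mu : {measure set T -> \bar R})
    (f_ : nat -> T -> R) (f g : T -> R) :
  (forall k, mu.-integrable setT (EFin \o f_ k)) -> mu.-integrable setT (EFin \o f) ->
  (\int[mu]_x `|f_ k x - f x|%:E)%E @[k --> \oo] --> 0%E ->
  bounded_measurable g ->
  \int[mu]_x (f_ k x * g x) @[k --> \oo] --> \int[mu]_x (f x * g x).
Proof.
move=> intf_ intf f_f bg; have [mg [C gC]] := bg.
have u0 : \int[mu]_x `|f_ k x - f x| @[k --> \oo] --> (0 : R) by exact: fine_cvg f_f.
(* [C] is merely some upper bound, possibly 0, or negative if [T] is empty; [|C| + 1] can be divided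
   by. *)
have C1 : 0 < `|C| + 1 by rewrite ltr_wpDl.
have int_dist k : mu.-integrable setT (EFin \o (fun x => f_ k x - f x)).
  have := integrableB measurableT (intf_ k) intf.
  by apply: eq_integrable => // x _ /=; rewrite EFinB.
have int_norm k : mu.-integrable setT (EFin \o (fun x => `|f_ k x - f x|)).
  exact: (integrable_norm (int_dist k)).
have le k : `|\int[mu]_x (f x * g x) - \int[mu]_x (f_ k x * g x)| <=
    (`|C| + 1) * \int[mu]_x `|f_ k x - f x|.
  rewrite distrC -RintegralB//; try exact: integrable_bounded_mul.
  under eq_Rintegral do rewrite -mulrBl.
  have intp := integrable_bounded_mul (int_dist k) bg.
  rewrite (le_trans (le_normr_Rintegral _ intp))// -RintegralZl//.
  apply: le_Rintegral => //.
  - exact: (integrable_norm intp).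
  - have := @integrableZl _ _ _ mu setT measurableT (`|C| + 1) _ (int_norm k).
    by apply: eq_integrable => // x _ /=; rewrite EFinM.
  - move=> x _; rewrite normrM mulrC ler_wpM2r// (le_trans (gC x))//.
    by rewrite (le_trans (ler_norm _))// lerDl.
apply/cvgrPdist_le => e e0; near=> k; apply: (le_trans (le k)).
rewrite mulrC -ler_pdivlMr//; near: k.
have /cvgrPdist_le /(_ _ (divr_gt0 e0 C1)) := u0.
by apply: filterS => k; rewrite sub0r normrN; apply: le_trans; rewrite ler_norm.
Unshelve. all: by end_near. Qed.

End lower_semicontinuity.

Unset Implicit Arguments.

(** The first claim assumes a finite lower limit because convergence in L^1 does not prevent the
    variations from blowing up, in which case the limit may fail to lie in BV^alpha. *)
Theorem proposition3p3 (R : realType) (n : nat) (hn : (0 < n)%N)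
  (alpha : R) (halpha : 0 < alpha < 1)
  (f_ : nat -> 'rV[R]_n -> R) (D_ : nat -> vector_measure R n)
  (hBV : forall k, BVfrac alpha (f_ k))
  (hD : forall k, is_frac_gradient alpha (f_ k) (D_ k))
  (f : 'rV[R]_n -> R)
  (hf : (lebesgue_rV n).-integrable setT (EFin \o f))
  (hlim : (\int[lebesgue_rV n]_x `|f_ k x - f x|%:E)%E @[k --> \oo] --> 0%E) :
  ((limn_einf (fun k => variation_measure (D_ k) setT) < +oo)%E ->
     BVfrac alpha f) /\
  (forall D : vector_measure R n, is_frac_gradient alpha f D ->
     forall U : set 'rV[R]_n, open U ->
       (variation_measure D U
          <= limn_einf (fun k => variation_measure (D_ k) U))%E).
Proof.
have coord_mf (phi : 'rV[R]_n -> 'rV[R]_n) i : test_field phi ->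
    measurable_fun setT (fun x => phi x ord0 i).
  move=> [/(_ [::])[cphi _] _]; apply: continuous_rV_measurable => y.
  apply: (@continuous_comp _ _ _ phi (fun v : 'rV[R]_n => v ord0 i)); first exact: cphi.
  exact: coord_continuous.
have key (U : set 'rV[R]_n) phi : open U -> test_field phi ->
    (forall x, enorm (phi x) <= 1) -> (forall x, ~ U x -> phi x = 0) ->
    ((\int[lebesgue_rV n]_x (f x * frac_div alpha phi x))%:E <=
      limn_einf (fun k => variation_measure (D_ k) U))%E.
  move=> oU tphi phi1 phiU.
  have cv : (\int[lebesgue_rV n]_x (f_ k x * frac_div alpha phi x))%:E @[k --> \oo] -->
      (\int[lebesgue_rV n]_x (f x * frac_div alpha phi x))%:E.
    apply/fine_cvgP; split; first exact: nearW.
    apply: cvg_integral_mul => //; first by move=> k; have [] := hBV k.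
    exact: frac_div_bounded_measurable.
  (* The integrals converge, so their limit is their [limn_einf]; comparing lower limits then
     requires no convergence of the variations. *)
  rewrite -(cvg_limn_einf_sup cv).1; apply: le_limn_einf => k.
  rewrite (hD k phi tphi); apply: ler_variation_measure => //.
    exact: open_rV_measurable.
  by move=> i; exact: coord_mf.
split=> [fin|D hfD U oU].
  split => //; apply: le_lt_trans fin; apply: ge_ereal_sup => _ [phi [tphi phiN] <-].
  have cphi : continuous phi by have [/(_ [::])[]] := tphi.
  (* [BVfrac] constrains the essential supremum of the field while [key] wants a bound at every
     point; continuity of [phi] bridges the two. *)
  apply: (key setT phi openT tphi (ess_bounded_enorm hn cphi phiN)) => x.
  by case.
apply: variation_measure_le => // phi tphi phi1 phiU.
by rewrite -hfD//; exact: key.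
Qed.
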